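(* Fix $\vartheta>0$ and let $I_n^{(\vartheta)}$ be the internal path length of a Hoppe tree with parameter $\vartheta$ and $n$ nodes (the trees for $n=1,2,\ldots$ being generated by one growth process). Then $$\frac{I_n^{(\vartheta)}-n\log n}{n} \to X^{(\vartheta)}$$ almost surely and in $L_2$, for a non-degenerate random variable $X^{(\vartheta)}$. The distribution $\mathcal{L}(X^{(\vartheta)})$ is the only integrable solution of the distributional fixed point equation $$X^{(\vartheta)} \stackrel{d}{=} (1-B)X^{(\vartheta)}+ B \widetilde{X}^{(1)} + B\log(B)+(1-B)\log(1-B)+B,$$ where $X^{(\vartheta)}$, $\widetilde{X}^{(1)}$ and $B$ are independent, $B$ has the beta$(1,\vartheta)$ distribution, and $\widetilde{X}^{(1)}$ is distributed as $X^{(1)}$ (the corresponding limit for $\vartheta=1$). For $\vartheta\neq 1$, the solution of this fixed point equation is unique even without the integrability assumption.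
   Context: Hoppe tree with parameter $\vartheta>0$: the tree is grown by successive insertion of nodes, all on one probability space. Initially there is only the root. In each step a parent node is chosen among the existing nodes, independently of the past, with probability proportional to its weight, where the root has weight $\vartheta$ and every other node has weight $1$; a new node is attached as a child of the chosen node. The internal path length is the sum over all nodes of their distances to the root. For $\vartheta=1$ the tree is the random recursive tree. The beta$(1,\vartheta)$ distribution has Lebesgue density $x\mapsto \vartheta(1-x)^{\vartheta-1}$ on $[0,1]$. *)

(* Defs.v *)
From HB Require Import structures.
From mathcomp Require Import all_boot all_order all_algebra.
From mathcomp Require Import all_classical all_reals all_analysis.

Set Implicit Arguments.
Unset Strict Implicit.
Unset Printing Implicit Defensive.

Import Order.TTheory GRing.Theory Num.Theory.
Import numFieldNormedType.Exports.

Local Open Scope classical_set_scope.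
Local Open Scope ring_scope.

Section HoppeDefs.
Context {R : realType}.

(* Probability that node k (k >= 1, inserted at step k; nodes 0..k-1 exist,
   node 0 is the root) chooses node j as its parent: the root has weight
   theta, every other node weight 1. *)
Definition hoppe_w (theta : R) (k j : nat) : R :=
  if (j < k)%N then (if j == 0%N then theta else 1) / (theta + (k.-1)%:R)
  else 0.

(* A Hoppe growth process on (T, P): parent k is the parent of node k
   (k >= 1).  Each parent is chosen independently of the past with the
   weights above; equivalently, the finite-dimensional laws of the parent
   choices are the corresponding products. *)
Definition hoppe_process d (T : measurableType d) (P : probability T R)
    (theta : R) (parent : nat -> T -> nat) : Prop :=
  (forall k j, measurable (parent k @^-1` [set j])) /\
  (forall (n : nat) (v : nat -> nat),
     P [set t | forall k, (1 <= k < n)%N -> parent k t = v k]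
     = (\prod_(1 <= k < n) hoppe_w theta k (v k))%:E).

End HoppeDefs.

Fixpoint depth_fuel (par : nat -> nat) (fuel j : nat) : nat :=
  match fuel with
  | 0 => 0
  | f.+1 => if j == 0 then 0 else (depth_fuel par f (par j)).+1
  end.

(* distance of node k to the root (parents have smaller labels, so k steps
   of fuel suffice) *)
Definition depth (par : nat -> nat) (k : nat) : nat := depth_fuel par k k.

Definition ipl (par : nat -> nat) (n : nat) : nat :=
  \sum_(k < n) depth par k.

Section LawDefs.
Context {R : realType}.

Definition norm_ipl {T : Type} (parent : nat -> T -> nat) (n : nat) (t : T)
  : R := ((ipl (parent ^~ t) n)%:R - n%:R * ln (n%:R : R)) / n%:R.

Definition has_law d (T : measurableType d) (P : probability T R)
    (X : T -> R) (mu : set R -> \bar R) : Prop :=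
  forall A : set R, measurable A -> P (X @^-1` A) = mu A.

Definition law d (T : measurableType d) (P : probability T R) (X : T -> R)
  : set R -> \bar R := fun A => P (X @^-1` A).

Definition indep3 d (T : measurableType d) (P : probability T R)
    (X Y Z : T -> R) : Prop :=
  forall A B C : set R, measurable A -> measurable B -> measurable C ->
    P (X @^-1` A `&` Y @^-1` B `&` Z @^-1` C)
    = (P (X @^-1` A) * P (Y @^-1` B) * P (Z @^-1` C))%E.

Definition beta1_distributed d (T : measurableType d) (P : probability T R)
    (theta : R) (B : T -> R) : Prop :=
  forall A : set R, measurable A ->
    P (B @^-1` A) = (\int[@lebesgue_measure R]_(x in A `&` [set y : R | (0 <= y <= 1)%R])
                      ((theta * powR (1 - x) (theta - 1))%R)%:E)%E.

Definition fpe_rhs (x xt b : R) : R :=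
  (1 - b) * x + b * xt + b * ln b + (1 - b) * ln (1 - b) + b.

Definition fpe_on d (T : measurableType d) (Q : probability T R) (theta : R)
    (nu mu : set R -> \bar R) (X Xt B : T -> R) : Prop :=
  measurable_fun setT X /\ measurable_fun setT Xt /\ measurable_fun setT B /\
  indep3 Q X Xt B /\ has_law Q X mu /\ has_law Q Xt nu /\
  beta1_distributed Q theta B /\
  has_law Q (fun t => fpe_rhs (X t) (Xt t) (B t)) mu.

Definition fpe_solution (theta : R) (nu mu : set R -> \bar R) : Prop :=
  forall d (T : measurableType d) (Q : probability T R) (X Xt B : T -> R),
    measurable_fun setT X -> measurable_fun setT Xt -> measurable_fun setT B ->
    indep3 Q X Xt B -> has_law Q X mu -> has_law Q Xt nu ->
    beta1_distributed Q theta B ->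
    has_law Q (fun t => fpe_rhs (X t) (Xt t) (B t)) mu.

Definition fpe_solution_some (theta : R) (nu mu : set R -> \bar R) : Prop :=
  exists d (T : measurableType d) (Q : probability T R) (X Xt B : T -> R),
    fpe_on Q theta nu mu X Xt B.

End LawDefs.

(* Main.v *)
(* Let [W = theta + n - 1] be the total weight. Then [I_n / W - h_n], with
   [h_n = sum_(j < n-1) 1 / (theta + j + 1)], is a martingale. The mean squared
   depth of a random node is of order [(log n) ^ 2], so the increments have second
   moments of order [(log n / n) ^ 2], which are summable. Kolmogorov's inequality
   gives the almost sure limit, and the second moments of the increments give L2
   convergence and a positive variance.

   Split the tree at the first child of the root. The subtree of this child is a
   random recursive tree, the rest is again a Hoppe tree, and their sizes follow a
   Polya urn with initial masses [theta] and [1], that is, a binomial distribution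
   mixed over [B ~ beta(1, theta)]. Concentration of the binomial (Bernstein
   polynomials) yields the fixed point equation for the limit, tested against
   bounded Lipschitz functions.

   Uniqueness: for fixed laws of [X^(1)] and [B], the equation is affine in the
   unknown law. The operator [f |-> (x |-> E f ((1 - B) x + ...))] multiplies Lipschitz
   constants by [E (1 - B) < 1], so its iterates on [f] tend to constants, and the
   integral of [f] under any solution is the limit of these constants. No
   integrability is involved. *)
Require Import Defs.
From HB Require Import structures.
From mathcomp Require Import all_boot all_order all_algebra.
From mathcomp Require Import all_classical all_reals all_analysis.
From mathcomp Require Import ring lra measurable_realfun.

Set Implicit Arguments.
Unset Strict Implicit.
Unset Printing Implicit Defensive.

Import Order.TTheory GRing.Theory Num.Theory.
Import numFieldNormedType.Exports.

Local Open Scope classical_set_scope.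
Local Open Scope ring_scope.

(** All finite-time expectations go through [grow]: one application is the conditional mean over the
    next insertion, and [expect_depths] turns the mean of a functional of the tree after [m]
    insertions into [iter m (grow th)] at the empty list. Martingale property, variance and maximal
    inequality thus become algebra on finite lists. The price is that only genuine trees are
    encoded, whereas a process may pick a missing parent on a null set; such choices are redirected
    to the root and the results carried back at the end.

    The passage from the urn to the beta mixture rests on one moment identity, an integration by
    parts against the beta density: the moments of [B ^+ ka * (1 - B) ^+ al] split exactly in the
    proportions of the urn. The split at the first child is exact at every size, because the
    logarithms combine into the terms in [B] of the fixed point equation, evaluated at the relative
    size of the subtree. The only errors in the limit are therefore the L1 distances of the two
    parts from their limits, weighted by their shares, and the fluctuation of that share about
    [B]. *)

(** * The growth operator, the path length martingale and its variance *)

Section GrowthOperator.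
Context {R : realType}.
Implicit Types (th a b e : R) (G : seq nat -> R) (s : seq nat).

(* A tree is encoded by the depths of its non-root nodes, newest first:
   suffixes of the list are the earlier trees, and one insertion conses
   [d.+1], where [d] is the depth of the parent. *)
Definition grow th G s : R :=
  (th * G (1%N :: s) + \sum_(d <- s) G (d.+1 :: s)) / (th + (size s)%:R).

Lemma weight_gt0 th k : 0 < th -> 0 < th + k%:R.
Proof. by move=> th0; rewrite ltr_pwDl. Qed.

Lemma sum_quadratic s (a b c : R) :
  \sum_(d <- s) (a + b * d%:R + c * d%:R ^+ 2) =
  (size s)%:R * a + b * (sumn s)%:R + c * \sum_(d <- s) d%:R ^+ 2.
Proof.
elim: s => [|d s IH]; first by rewrite !big_nil/=; ring.
by rewrite !big_cons IH/= natrD -natr1; ring.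
Qed.

Lemma eq_grow th G G' s : (forall d, G (d :: s) = G' (d :: s)) ->
  grow th G s = grow th G' s.
Proof.
move=> e; rewrite /grow e; congr ((_ + _) / _).
by apply: eq_bigr => d _; rewrite e.
Qed.

Lemma grow_linear th a b G G' s :
  grow th (fun u => a * G u + b * G' u) s = a * grow th G s + b * grow th G' s.
Proof.
by rewrite /grow big_split/= -!mulr_sumr; ring.
Qed.

Lemma grow_cst th c s : 0 < th -> grow th (fun=> c) s = c.
Proof.
move=> th0; rewrite /grow (eq_bigr (fun d => c + 0 * d%:R + 0 * d%:R ^+ 2)).
  rewrite sum_quadratic; have := weight_gt0 (size s) th0 => ?.
  by field; lra.
by move=> d _; ring.
Qed.

Lemma le_grow th G G' s : 0 < th -> (forall d, G (d :: s) <= G' (d :: s)) ->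
  grow th G s <= grow th G' s.
Proof.
move=> th0 le; rewrite /grow ler_wpM2r//.
  by rewrite invr_ge0 ltW// weight_gt0.
by apply: lerD; [rewrite ler_wpM2l// ltW|apply: ler_sum => d _].
Qed.

(** Only states exactly [j] insertions after [s] are visited. This is what allows [size u] to be
    replaced by a number and [drop j u] by the starting state. *)
Lemma eq_iter_grow th j G G' s :
  (forall v, size v = j -> G (v ++ s) = G' (v ++ s)) ->
  iter j (grow th) G s = iter j (grow th) G' s.
Proof.
elim: j s => [|j IH] s e /=; first exact: (e [::]).
apply: eq_grow => d; apply: IH => u uj.
by rewrite -cat_rcons e// size_rcons uj.
Qed.

Lemma iter_grow_linear th j a b G G' s :
  iter j (grow th) (fun u => a * G u + b * G' u) s =
  a * iter j (grow th) G s + b * iter j (grow th) G' s.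
Proof.
elim: j s => [//|j IH] s /=.
by rewrite -grow_linear; apply: eq_grow => d; exact: IH.
Qed.

Lemma iter_growZ th j a G s :
  iter j (grow th) (fun u => a * G u) s = a * iter j (grow th) G s.
Proof.
rewrite (@eq_iter_grow _ _ _ (fun u => a * G u + 0 * G u)).
  by rewrite iter_grow_linear mul0r addr0.
by move=> e _; rewrite mul0r addr0.
Qed.

Lemma iter_grow_cst th j c s : 0 < th -> iter j (grow th) (fun=> c) s = c.
Proof.
move=> th0; elim: j s => [//|j IH] s /=.
by rewrite -[RHS](grow_cst c s th0); apply: eq_grow => d; exact: IH.
Qed.

Lemma le_iter_grow th j G G' s : 0 < th ->
  (forall v, size v = j -> G (v ++ s) <= G' (v ++ s)) ->
  iter j (grow th) G s <= iter j (grow th) G' s.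
Proof.
move=> th0; elim: j s => [|j IH] s e /=; first exact: (e [::]).
apply: le_grow => // d; apply: IH => u uj.
by rewrite -cat_rcons e// size_rcons uj.
Qed.

Lemma iter_grow_fix th j G s : 0 < th -> (forall u, grow th G u = G u) ->
  iter j (grow th) G s = G s.
Proof.
move=> th0 e; elim: j s => [//|j IH] s /=.
by rewrite -[RHS]e; apply: eq_grow => d; exact: IH.
Qed.

Definition harm th k : R := \sum_(j < k) (th + j.+1%:R)^-1.

(** The root is not listed, so a list of length [n - 1] encodes [n] nodes and [th + size s] is the
    total weight. *)
Definition ipl_mart th s : R :=
  (sumn s)%:R / (th + (size s)%:R) - harm th (size s).

Lemma harmS th k : harm th k.+1 = harm th k + (th + k.+1%:R)^-1.
Proof. by rewrite /harm big_ord_recr. Qed.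

Lemma harm_ge0 th k : 0 < th -> 0 <= harm th k.
Proof.
by move=> th0; apply: sumr_ge0 => i _; rewrite invr_ge0 ltW// weight_gt0.
Qed.

(** The increment is the deviation of the parent's depth [d] from its conditional mean, divided by
    the new total weight. Both the martingale property and the conditional variance follow from this
    form. *)
Lemma ipl_mart_cons th s d : 0 < th ->
  ipl_mart th (d.+1 :: s) = ipl_mart th s +
   (d%:R - (sumn s)%:R / (th + (size s)%:R)) / (th + (size s)%:R + 1).
Proof.
move=> th0; rewrite /ipl_mart/= harmS natrD -!natr1.
have W0 := weight_gt0 (size s) th0.
set W := th + (size s)%:R in W0 *; set I := (sumn s)%:R.
have -> : th + ((size s)%:R + 1) = W + 1 by rewrite /W; ring.
by field; apply/andP; split; lra.
Qed.

Lemma grow_ipl_mart th s : 0 < th -> grow th (ipl_mart th) s = ipl_mart th s.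
Proof.
move=> th0; have W0 := weight_gt0 (size s) th0.
rewrite /grow (ipl_mart_cons s 0)//.
set k := (size s)%:R in W0 *; set I := (sumn s)%:R; set M := ipl_mart th s.
rewrite (eq_bigr (fun d => (M - I / (th + k) / (th + k + 1)) +
  (th + k + 1)^-1 * d%:R + 0 * d%:R ^+ 2)).
  by rewrite sum_quadratic -/k -/I; field; apply/andP; split; lra.
by move=> d _; rewrite ipl_mart_cons// -/k -/I -/M; ring.
Qed.

Definition depth2 s : R := \sum_(d <- s) d%:R ^+ 2.

(** The added term is the conditional variance of the parent's depth over the squared new weight;
    the root has depth 0 and does not enter [depth2]. *)
Lemma grow_sqr_ipl_mart th a s : 0 < th ->
  grow th (fun u => (ipl_mart th u - a) ^+ 2) s =
  (ipl_mart th s - a) ^+ 2 +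
  (depth2 s / (th + (size s)%:R) - ((sumn s)%:R / (th + (size s)%:R)) ^+ 2) /
  (th + (size s)%:R + 1) ^+ 2.
Proof.
move=> th0; have W0 := weight_gt0 (size s) th0.
rewrite /grow (ipl_mart_cons s 0)//.
set k := (size s)%:R in W0 *; set I := (sumn s)%:R; set M := ipl_mart th s.
rewrite (eq_bigr (fun d => ((M - a) - I / (th + k) / (th + k + 1)) ^+ 2
    + (2 * ((M - a) - I / (th + k) / (th + k + 1)) / (th + k + 1)) * d%:R
    + ((th + k + 1) ^+ 2)^-1 * d%:R ^+ 2)).
  rewrite sum_quadratic -/(depth2 s) -/k -/I.
  by field; apply/andP; split; lra.
move=> d _; rewrite ipl_mart_cons// -/k -/I -/M.
by field; apply/andP; split; lra.
Qed.

Lemma depth2_sumn th s : 0 < th ->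
  ((sumn s)%:R / (th + (size s)%:R)) ^+ 2 <= depth2 s / (th + (size s)%:R).
Proof.
move=> th0; have W0 := weight_gt0 (size s) th0.
set x : R := (sumn s)%:R / _.
(* Weighted squared deviations from the mean depth [x]; the root, of weight [th] and depth 0,
   contributes [th * x ^+ 2]. *)
have : 0 <= \sum_(d <- s) (d%:R - x) ^+ 2 + th * x ^+ 2.
  apply: addr_ge0; last by rewrite mulr_ge0 ?sqr_ge0 ?ltW.
  by apply: sumr_ge0 => d _; exact: sqr_ge0.
rewrite (eq_bigr (fun d => x ^+ 2 + (- 2 * x) * d%:R + 1 * d%:R ^+ 2)); last first.
  by move=> d _; ring.
rewrite sum_quadratic -/(depth2 s).
have -> : (sumn s)%:R = x * (th + (size s)%:R) by rewrite /x divfK// gt_eqF.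
by move=> h; rewrite ler_pdivlMr//; nra.
Qed.

Lemma grow_sqr_ipl_mart0 th s : 0 < th ->
  grow th (fun u => ipl_mart th u ^+ 2) s = ipl_mart th s ^+ 2 +
  (depth2 s / (th + (size s)%:R) - ((sumn s)%:R / (th + (size s)%:R)) ^+ 2) /
  (th + (size s)%:R + 1) ^+ 2.
Proof.
move=> th0; rewrite -[X in X ^+ 2 + _]subr0 -grow_sqr_ipl_mart//.
by apply: eq_grow => d; rewrite subr0.
Qed.

Lemma sqr_ipl_mart_submart th a s : 0 < th ->
  (ipl_mart th s - a) ^+ 2 <= grow th (fun u => (ipl_mart th u - a) ^+ 2) s.
Proof.
move=> th0; rewrite grow_sqr_ipl_mart// lerDl mulr_ge0//.
  by rewrite subr_ge0 depth2_sumn.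
by rewrite invr_ge0 sqr_ge0.
Qed.

Lemma iter_sqr_ipl_mart_submart th a j s : 0 < th ->
  (ipl_mart th s - a) ^+ 2 <=
  iter j (grow th) (fun u => (ipl_mart th u - a) ^+ 2) s.
Proof.
move=> th0; elim: j s => [//|j IH] s /=.
by apply: (le_trans (sqr_ipl_mart_submart a s th0)); exact: le_grow.
Qed.

Lemma iter_sqrB_ipl_mart th a j s : 0 < th ->
  iter j (grow th) (fun u => (ipl_mart th u - a) ^+ 2) s =
  iter j (grow th) (fun u => ipl_mart th u ^+ 2) s
  - 2 * a * ipl_mart th s + a ^+ 2.
Proof.
move=> th0.
rewrite (@eq_iter_grow _ _ _ (fun u => 1 * (1 * ipl_mart th u ^+ 2 +
  (- 2 * a) * ipl_mart th u) + 1 * (fun=> a ^+ 2) u)); last by move=> e _; ring.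
rewrite iter_grow_linear (iter_grow_linear _ _ 1) iter_grow_cst//.
rewrite (@iter_grow_fix _ _ (ipl_mart th))//; first by ring.
by move=> u; exact: grow_ipl_mart.
Qed.

Definition mart_var th j : R :=
  iter j (grow th) (fun u => ipl_mart th u ^+ 2) [::].

Lemma grow_depth2 th s : 0 < th ->
  grow th (fun u => depth2 u / (th + (size u)%:R)) s =
  depth2 s / (th + (size s)%:R) +
  (2 * ((sumn s)%:R / (th + (size s)%:R)) + 1) / (th + (size s).+1%:R).
Proof.
move=> th0; have W0 := weight_gt0 (size s) th0.
rewrite /grow/= /depth2 !big_cons -/(depth2 s).
rewrite (eq_bigr (fun d => (1 + depth2 s) / (th + (size s).+1%:R) +
  2 / (th + (size s).+1%:R) * d%:R +
  (th + (size s).+1%:R)^-1 * d%:R ^+ 2)); last first.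
  by move=> d _; rewrite big_cons -/(depth2 s) -natr1; ring.
rewrite sum_quadratic -/(depth2 s) -!natr1.
by field; apply/andP; split; lra.
Qed.

(** The martingale starts at 0, so its mean stays 0; this identifies [harm] as the expected depth of
    the next parent. *)
Lemma iter_depth th j : 0 < th ->
  iter j (grow th) (fun u => (sumn u)%:R / (th + (size u)%:R)) [::] = harm th j.
Proof.
move=> th0; have := @iter_grow_fix th j (ipl_mart th) [::] th0
  (fun u => grow_ipl_mart u th0).
rewrite {2}/ipl_mart/= mul0r/= /harm big_ord0 subrr -/(harm th j).
rewrite (@eq_iter_grow _ _ _ (fun u => 1 * ((sumn u)%:R / (th + (size u)%:R)) +
  (- harm th j) * 1)); last first.
  by move=> e ej; rewrite /ipl_mart cats0 ej; ring.
rewrite iter_grow_linear iter_grow_cst// => /eqP; rewrite mulr1 mul1r.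
by rewrite subr_eq0 => /eqP.
Qed.

(** With [w] the new summand of [harm], one insertion adds [(2 h + 1) w] to the left side, while
    [(2 h + 1) h] grows by [(4 h + 2 w + 1) w]. *)
Lemma iter_depth2_le th j : 0 < th ->
  iter j (grow th) (fun u => depth2 u / (th + (size u)%:R)) [::]
  <= (2 * harm th j + 1) * harm th j.
Proof.
move=> th0; elim: j => [|j IH].
  by rewrite /= /depth2 big_nil mul0r /harm big_ord0 mulr0.
rewrite iterSr (@eq_iter_grow _ _ _ (fun u => 1 * (depth2 u / (th + (size u)%:R))
  + (th + j.+1%:R)^-1 * (2 * ((sumn u)%:R / (th + (size u)%:R)) +
   1 * (fun=> 1) u))); last first.
  by move=> e ej; rewrite cats0 grow_depth2// ej; ring.
rewrite iter_grow_linear (iter_grow_linear _ _ 2) iter_depth// iter_grow_cst//.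
rewrite harmS; have := weight_gt0 j.+1 th0; rewrite -invr_gt0.
move: (th + _)^-1 => w w0; have h0 := harm_ge0 j th0; nra.
Qed.

Lemma mart_varS th j : 0 < th ->
  mart_var th j <= mart_var th j.+1 <=
  mart_var th j + (2 * harm th j + 1) * harm th j / (th + j.+1%:R) ^+ 2.
Proof.
move=> th0; rewrite /mart_var iterSr; apply/andP; split.
  apply: le_iter_grow => // e _; rewrite grow_sqr_ipl_mart0// lerDl mulr_ge0//.
    by rewrite subr_ge0 depth2_sumn.
  by rewrite invr_ge0 sqr_ge0.
have W0 := weight_gt0 j.+1 th0.
apply: (@le_trans _ _ (iter j (grow th) (fun u => 1 * (ipl_mart th u ^+ 2) +
  ((th + j.+1%:R) ^+ 2)^-1 * (depth2 u / (th + (size u)%:R))) [::])).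
  apply: le_iter_grow => // e ej.
  rewrite grow_sqr_ipl_mart0// mul1r lerD2l mulrC cats0 ej.
  rewrite -addrA natr1 ler_wpM2l ?invr_ge0 ?sqr_ge0//.
  by rewrite lerBlDr lerDl sqr_ge0.
rewrite iter_grow_linear mul1r lerD2l mulrC ler_wpM2r ?invr_ge0 ?sqr_ge0//.
exact: iter_depth2_le.
Qed.

(* The potential [(2 h ^+ 2 + 5 h + 7) / (th + j)] decreases at each step by at
   least the variance increment. *)
Lemma mart_var_bounded th j : 0 < th -> mart_var th j <= 7 / th.
Proof.
move=> th0.
suff : mart_var th j +
    (2 * harm th j ^+ 2 + 5 * harm th j + 7) / (th + j%:R) <= 7 / th.
  apply: le_trans; rewrite lerDl mulr_ge0//; last first.
    by rewrite invr_ge0 ltW// weight_gt0.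
  by have := harm_ge0 j th0; nra.
elim: j => [|j].
  rewrite /mart_var/= /ipl_mart/= /harm !big_ord0 mul0r subrr expr0n/=.
  by rewrite !mulr0 !addr0 !add0r.
apply: le_trans; have /andP[_ V] := mart_varS j th0; rewrite harmS.
apply: le_trans (lerD V (lexx _)) _; rewrite -!natr1 -[leLHS]addrA lerD2l.
rewrite [th + (j%:R + 1)]addrA; have := weight_gt0 j th0.
set w := th + j%:R; have := harm_ge0 j th0.
move: (harm th j) => h h0 w0; rewrite -subr_ge0.
have w1 : 0 < w + 1 by lra.
(* In units of [(w + 1) ^- 2], the decay of [1 / w] yields at least [2 h ^+ 2 + 5 h + 7], the growth
   of [h] costs [4 h + 5 + 2 / (w + 1)], and the variance costs [2 h ^+ 2 + h]. Hence the
   coefficients 5 = 1 + 4 and 7 = 5 + 2. *)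
rewrite (_ : _ - _ = (2 * h ^+ 2 + 5 * h + 7) / (w * (w + 1) ^+ 2) + 2 / (w + 1) ^+ 2 * (1 - (w + 1)^-1)); last first.
  by field; apply/andP; split; lra.
rewrite addr_ge0// mulr_ge0//; first by nra.
- by rewrite invr_ge0 mulr_ge0 ?sqr_ge0// ltW.
- by rewrite mulr_ge0// invr_ge0 sqr_ge0.
- by rewrite subr_ge0 invf_le1//; lra.
Qed.

Lemma mart_var_nondecreasing th : 0 < th -> nondecreasing_seq (mart_var th).
Proof.
by move=> th0; apply/nondecreasing_seqP => j; have /andP[] := mart_varS j th0.
Qed.

Lemma mart_var_cvg th : 0 < th -> cvgn (mart_var th).
Proof.
move=> th0; apply: nondecreasing_is_cvgn; first exact: mart_var_nondecreasing.
by exists (7 / th) => _ [j _ <-]; exact: mart_var_bounded.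
Qed.

(** The first insertion is forced, but the second new node has depth 1 or 2, both with positive
    probability. This is the source of non-degeneracy. *)
Lemma mart_var2_gt0 th : 0 < th -> 0 < mart_var th 2.
Proof.
move=> th0; rewrite /mart_var/= (@eq_grow th _ (fun u =>
  (ipl_mart th u ^+ 2) + (depth2 u / (th + (size u)%:R) -
  ((sumn u)%:R / (th + (size u)%:R)) ^+ 2) / (th + (size u)%:R + 1) ^+ 2));
  last first.
  by move=> d; rewrite -grow_sqr_ipl_mart0.
rewrite /grow big_nil/= addr0 /depth2 big_seq1 /ipl_mart /harm !big_ord_recl !big_ord0/=.
rewrite !addn0 !addr0 mulrAC divff ?mul1r ?gt_eqF//.
rewrite subrr expr0n add0r divr_gt0 ?exprn_gt0//; last by lra.
have x1 : (th + 1)^-1 < 1 by rewrite invf_lt1; lra.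
have x0 : 0 < (th + 1)^-1 by rewrite invr_gt0; lra.
by rewrite expr1n !mul1r; nra.
Qed.

(* Orthogonality of increments; [drop j u] is the state [j] steps earlier. *)
Lemma mart_var_increment th i j : 0 < th ->
  iter (i + j) (grow th)
    (fun u => (ipl_mart th u - ipl_mart th (drop j u)) ^+ 2) [::] =
  mart_var th (i + j) - mart_var th i.
Proof.
move=> th0; rewrite iterD (@eq_iter_grow _ _ _ (fun u =>
  1 * iter j (grow th) (fun v => ipl_mart th v ^+ 2) u +
  (-1) * ipl_mart th u ^+ 2)).
  by rewrite iter_grow_linear -iterD mul1r mulN1r.
move=> e _; rewrite (@eq_iter_grow _ _ _
  (fun v => (ipl_mart th v - ipl_mart th (e ++ [::])) ^+ 2)); last first.
  by move=> v vj; rewrite drop_size_cat.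
by rewrite iter_sqrB_ipl_mart//; ring.
Qed.

(** Since suffixes are earlier trees, this is the event that the martingale was at distance at least
    [e] from [a] now or at one of the last [j] times. *)
Definition far th (a e : R) (j : nat) (u : seq nat) : bool :=
  [exists i : 'I_j.+1, e <= `|ipl_mart th (drop i u) - a|].

(* Kolmogorov's maximal inequality, by induction on the first step. *)
Lemma iter_far_le th a e j s : 0 < th -> 0 < e ->
  iter j (grow th) (fun u => (far th a e j u)%:R) s <=
  iter j (grow th) (fun u => (ipl_mart th u - a) ^+ 2) s / e ^+ 2.
Proof.
move=> th0 e0.
have sqr x : e <= `|x| -> 1 <= x ^+ 2 / e ^+ 2.
  move=> ex; rewrite ler_pdivlMr ?exprn_gt0// mul1r -(real_normK (num_real x)).
  by rewrite lerXn2r// nnegrE ltW.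
(* If [s] is already far, the indicator is at most 1 and the submartingale property of the square
   suffices; otherwise the first step is examined. *)
have [es|es] := leP e `|ipl_mart th s - a|.
  apply: (@le_trans _ _ 1).
    rewrite -[leRHS](@iter_grow_cst th j _ s)//; apply: le_iter_grow => // u _.
    by rewrite lern1; case: far.
  apply: (le_trans (sqr _ es)); rewrite ler_wpM2r ?invr_ge0 ?sqr_ge0//.
  exact: iter_sqr_ipl_mart_submart.
elim: j s es => [|j IH] s es.
  rewrite /= /far (_ : [exists _, _] = false) ?divr_ge0 ?sqr_ge0//.
  by apply/negbTE/existsPn => i; rewrite ord1 drop0 -ltNge.
rewrite !iterS; apply: (@le_trans _ _ (grow th (fun u => (e ^+ 2)^-1 *
    iter j (grow th) (fun u => (ipl_mart th u - a) ^+ 2) u + 0 * 0) s)).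
  apply: le_grow => // d; rewrite mul0r addr0 mulrC.
  (* The oldest index of the window is [s] itself, which is not far, so the window shrinks to length
     [j]. *)
  rewrite (@eq_iter_grow _ _ _ (fun u => (far th a e j u)%:R)); last first.
    move=> u uj; congr (_%:R); congr nat_of_bool; apply/idP/idP.
      case/existsP => i ei; apply/existsP.
      have ij : (i < j.+1)%N.
        rewrite ltn_neqAle -ltnS ltn_ord andbT; apply/eqP => ij.
        by move: ei; rewrite ij -cat_rcons drop_size_cat ?size_rcons ?uj// leNgt es.
      by exists (Ordinal ij).
    by case/existsP => i ei; apply/existsP; exists (widen_ord (leqnSn _) i).
  have [eds|eds] := leP e `|ipl_mart th (d :: s) - a|; last exact: IH.
  apply: (@le_trans _ _ 1).
    rewrite -[leRHS](@iter_grow_cst th j _ (d :: s))//; apply: le_iter_grow => // u _.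
    by rewrite lern1; case: far.
  apply: (le_trans (sqr _ eds)); rewrite ler_wpM2r ?invr_ge0 ?sqr_ge0//.
  exact: iter_sqr_ipl_mart_submart.
by rewrite grow_linear mul0r addr0 mulrC.
Qed.

Lemma iter_far_increment_le th e i j : 0 < th -> 0 < e ->
  iter (i + j) (grow th)
    (fun u => (far th (ipl_mart th (drop j u)) e j u)%:R) [::] <=
  (mart_var th (i + j) - mart_var th i) / e ^+ 2.
Proof.
move=> th0 e0; rewrite -mart_var_increment// !iterD.
rewrite [leRHS]mulrC -iter_growZ; apply: le_iter_grow => // u _; rewrite [leRHS]mulrC.
set a := ipl_mart th (u ++ [::]).
rewrite (@eq_iter_grow _ _ _ (fun v => (far th a e j v)%:R)); last first.
  by move=> v vj; rewrite drop_size_cat.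
rewrite (@eq_iter_grow _ _ (fun v => (_ - _) ^+ 2)
  (fun v => (ipl_mart th v - a) ^+ 2)); last first.
  by move=> v vj; rewrite drop_size_cat.
exact: iter_far_le.
Qed.

End GrowthOperator.

(** * Recursive parent functions, depth lists and finite sums over trees *)

Section IncreasingTrees.
Implicit Types (f g par : nat -> nat).

Definition recursive par := forall k, (0 < k)%N -> (par k < k)%N.

Definition agree m f g : bool := [forall k : 'I_m, f k.+1 == g k.+1].

Lemma agreeP m f g :
  reflect (forall k, (0 < k <= m)%N -> f k = g k) (agree m f g).
Proof.
apply: (iffP forallP) => [h [//|k] km|h k].
  exact: (eqP (h (Ordinal km))).
by apply/eqP/h/ltn_ord.
Qed.

Definition upd f n j := fun k => if k == n then j else f k.

Lemma recursive_upd f m j : recursive f -> (j < m)%N -> recursive (upd f m j).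
Proof. by move=> rf jm k k0; rewrite /upd; case: eqP => [->|_]//; exact: rf. Qed.

Lemma agree_upd m f par j :
  agree m.+1 par (upd f m.+1 j) = agree m par f && (par m.+1 == j).
Proof.
apply/idP/idP => [/agreeP h|/andP[/agreeP h /eqP pj]].
  apply/andP; split; last by rewrite h ?leqnn// /upd eqxx.
  apply/agreeP => k /andP[k0 km]; rewrite h ?k0 ?leqW// /upd ifN//.
  by rewrite ltn_eqF.
apply/agreeP => k /andP[k0 km]; rewrite /upd; case: eqP => [->//|/eqP nk].
by apply: h; rewrite k0 -ltnS ltn_neqAle nk.
Qed.

Lemma depth_fuel_local f g n j k : recursive f -> agree k f g -> (j <= k)%N ->
  depth_fuel f n j = depth_fuel g n j.
Proof.
move=> rf /agreeP fg; elim: n j => [//|n IH] [//|j] jk /=.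
rewrite -fg// IH// (leq_trans _ jk)// ltnW//; exact: rf.
Qed.

Lemma depth_fuel_stable f n n' j : recursive f -> (j <= n)%N -> (j <= n')%N ->
  depth_fuel f n j = depth_fuel f n' j.
Proof.
move=> rf; elim: n n' j => [|n IH] [|n'] [|j]//= jn jn'.
have := rf j.+1 isT; rewrite ltnS => fj.
by rewrite (IH n')//; exact: (leq_trans fj).
Qed.

Lemma depthS f k : recursive f -> depth f k.+1 = (depth f (f k.+1)).+1.
Proof.
move=> rf; rewrite /depth /=; congr _.+1.
by apply: depth_fuel_stable => //; rewrite -ltnS; exact: rf.
Qed.

Lemma depth_local f g k : recursive f -> agree k f g -> depth f k = depth g k.
Proof. by move=> rf fg; rewrite /depth (@depth_fuel_local f g k k k). Qed.

Fixpoint depths par m : seq nat :=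
  if m is m'.+1 then depth par m :: depths par m' else [::].

Lemma size_depths par m : size (depths par m) = m.
Proof. by elim: m => //= m ->. Qed.

Lemma drop_depths par m j : drop j (depths par (m + j)) = depths par m.
Proof.
elim: j => [|j IH]; first by rewrite addn0 drop0.
by rewrite addnS.
Qed.

Lemma ipl_depths par m : ipl par m.+1 = sumn (depths par m).
Proof.
rewrite /ipl big_ord_recl/= add0n; elim: m => [|m IH] /=.
  by rewrite big_ord0.
by rewrite big_ord_recr/= IH addnC.
Qed.

Lemma agreeS m f g : agree m.+1 f g -> agree m f g.
Proof.
move=> /agreeP fg; apply/agreeP => k /andP[k0 km].
by apply: fg; rewrite k0 leqW.
Qed.

Lemma depths_local f g m : recursive f -> agree m f g -> depths f m = depths g m.
Proof.
move=> rf; elim: m => [//|m IH] fg /=.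
by rewrite IH ?(agreeS fg)// (depth_local rf fg).
Qed.

Lemma agree_updr m f j : agree m f (upd f m.+1 j).
Proof.
by apply/agreeP => k /andP[_ km]; rewrite /upd ifN// ltn_eqF.
Qed.

Lemma depths_upd f m j : recursive f -> (j < m.+1)%N ->
  depths (upd f m.+1 j) m.+1 = (depth f j).+1 :: depths f m.
Proof.
move=> rf jm; have ru := recursive_upd rf jm.
rewrite [LHS]/= depthS// -(depths_local rf (agree_updr m f j)).
congr (_.+1 :: _); rewrite {2}/upd eqxx; apply/esym/depth_local => //.
apply/agreeP => k /andP[k0 kj].
by move/agreeP: (agree_updr m f j) => -> //; rewrite k0 (leq_trans kj).
Qed.

Context {R : realType}.

Lemma sum_depths par m (H : nat -> R) :
  \sum_(d <- depths par m) H d = \sum_(i < m) H (depth par i.+1).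
Proof.
elim: m => [|m IH]; first by rewrite big_nil big_ord0.
by rewrite big_cons IH big_ord_recr/= addrC.
Qed.

(* Sum over all recursive trees on [m.+1] nodes, given by parent functions that
   vanish beyond [m]. *)
Fixpoint tree_sum (m : nat) (F : (nat -> nat) -> R) : R :=
  if m is m'.+1 then tree_sum m' (fun f => \sum_(j < m) F (upd f m j))
  else F (fun=> 0%N).

Lemma eq_tree_sum m F F' : (forall f, recursive f -> F f = F' f) ->
  tree_sum m F = tree_sum m F'.
Proof.
elim: m F F' => [|m IH] F F' e /=; first by apply: e.
apply: IH => f rf; apply: eq_bigr => j _; apply: e.
exact: recursive_upd.
Qed.

Lemma tree_sum_agree m par (Phi : (nat -> nat) -> R) : recursive par ->
  (forall f g, recursive f -> recursive g -> agree m f g -> Phi f = Phi g) ->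
  tree_sum m (fun f => (agree m par f)%:R * Phi f) = Phi par.
Proof.
move=> rp; elim: m Phi => [|m IH] Phi loc /=.
  rewrite (_ : agree _ _ _) ?mul1r; last by apply/agreeP => -[].
  by apply: loc => //; apply/agreeP => -[].
have pm : (par m.+1 < m.+1)%N by exact: rp.
rewrite (_ : tree_sum _ _ =
    tree_sum m (fun f => (agree m par f)%:R * Phi (upd f m.+1 (par m.+1)))).
  rewrite (IH (fun f => Phi (upd f m.+1 (par m.+1)))).
    apply: loc => //; first exact: recursive_upd.
    by apply/agreeP => k _; rewrite /upd; case: eqP => [->|].
  move=> f g rf rg /agreeP fg; apply: loc; [exact: recursive_upd|exact: recursive_upd|].
  apply/agreeP => k /andP[k0 km].
  by rewrite /upd; case: eqP => // /eqP nk; apply: fg; rewrite k0 -ltnS ltn_neqAle nk.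
apply: eq_tree_sum => f rf.
rewrite (bigD1 (Ordinal pm))//= agree_upd eqxx andbT big1 ?addr0// => j jp.
rewrite agree_upd (_ : par m.+1 == j = false) ?andbF ?mul0r//.
by apply/negbTE; apply: contraNneq jp => e; apply/eqP/val_inj; rewrite /= e.
Qed.

(** The counterpart of [tree_sum_agree]: with [Phi] equal to 1, the two say that the sum is the
    indicator that [par] is recursive up to [m]. *)
Lemma tree_sum_notin m par (Phi : (nat -> nat) -> R) :
  (exists2 k, (0 < k <= m)%N & (k <= par k)%N) ->
  tree_sum m (fun f => (agree m par f)%:R * Phi f) = 0.
Proof.
move=> [k km kp]; rewrite (@eq_tree_sum _ _ (fun=> 0)).
  elim: m {km} => [//|m IH] /=; rewrite -[RHS]IH; apply: eq_tree_sum => f _.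
  by rewrite big1.
move=> f rf; rewrite (_ : agree _ _ _ = false) ?mul0r//.
apply/negP => /agreeP /(_ k km) e; case/andP: km => /rf.
by rewrite -e ltnNge kp.
Qed.

(** The innermost sum runs over the parent of the last node and is one application of [grow]; the
    term [j = 0] is the root, which the depth list omits. *)
Lemma tree_sum_weights (th : R) m (G : seq nat -> R) :
  tree_sum m (fun f => (\prod_(1 <= k < m.+1) hoppe_w th k (f k)) *
     G (depths f m)) = iter m (grow th) G [::].
Proof.
elim: m G => [|m IH] G; first by rewrite /= big_geq// mul1r.
rewrite iterSr -IH /=; apply: eq_tree_sum => f rf.
under eq_bigr => j _.
  rewrite -[depth _ _ :: _]/(depths _ m.+1) depths_upd// big_nat_recr//=.
  rewrite {2}/upd eqxx (eq_big_nat _ _ (F2 := fun k => hoppe_w th k (f k))).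
    rewrite -mulrA; over.
  by move=> k /andP[_ km]; rewrite /upd ifN// ltn_eqF.
rewrite -mulr_sumr; congr (_ * _); rewrite big_ord_recl/=.
rewrite /grow sum_depths size_depths mulrDl mulr_suml; congr (_ + _).
  by rewrite /hoppe_w/= mulrAC.
apply: eq_bigr => i _; rewrite /hoppe_w /bump/= add1n ltnS ltn_ord.
by rewrite mulrC mul1r.
Qed.

End IncreasingTrees.

(** * Expectations of real random variables *)

Section RealExpectation.
Context d {T : measurableType d} {R : realType} (P : probability T R).
Implicit Types f g : T -> R.

Definition summable_rv f := P.-integrable setT (EFin \o f).

Lemma summable_cst c : summable_rv (fun=> c).
Proof. exact: finite_measure_integrable_cst. Qed.

Lemma summableD f g : summable_rv f -> summable_rv g ->
  summable_rv (fun t => f t + g t).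
Proof. by move=> hf hg; exact: (integrableD measurableT hf hg). Qed.

Lemma summableZ c f : summable_rv f -> summable_rv (fun t => c * f t).
Proof. by move=> hf; exact: (integrableZl measurableT c hf). Qed.

Lemma summableB f g : summable_rv f -> summable_rv g ->
  summable_rv (fun t => f t - g t).
Proof. by move=> hf hg; exact: (integrableB measurableT hf hg). Qed.

Lemma summable_sum I (r : seq I) (F : I -> T -> R) :
  (forall i, summable_rv (F i)) -> summable_rv (fun t => \sum_(i <- r) F i t).
Proof.
move=> iF; elim: r => [|i r IH].
  by rewrite (_ : (fun _ => _) = (fun=> 0)); [exact: summable_cst|
    apply/funext => t; rewrite big_nil].
rewrite (_ : (fun _ => _) = (fun t => F i t + \sum_(j <- r) F j t)).
  exact: summableD.
by apply/funext => t; rewrite big_cons.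
Qed.

Lemma summable_bounded f c : measurable_fun setT f -> (forall t, `|f t| <= c) ->
  summable_rv f.
Proof.
move=> mf fc; apply: measurable_bounded_integrable => //.
  by rewrite (le_lt_trans (probability_le1 P _))// ltry.
exists c; split; first exact: num_real.
by move=> x cx t _; exact: (le_trans (fc t) (ltW cx)).
Qed.

Lemma le_summable f g : measurable_fun setT f -> summable_rv g ->
  (forall t, `|f t| <= g t) -> summable_rv f.
Proof.
move=> mf ig fg; apply: (le_integrable measurableT _ _ ig) => /=.
  exact/measurable_EFinP.
by move=> t _; rewrite lee_fin; exact: (le_trans (fg t) (ler_norm _)).
Qed.

Lemma summable_measurable f : summable_rv f -> measurable_fun setT f.
Proof. by move=> /measurable_int /measurable_EFinP. Qed.

Lemma summable_norm f : summable_rv f -> summable_rv (fun t => `|f t|).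
Proof. exact: integrable_norm. Qed.

Lemma expect_cst c : \int[P]_t c = c :> R.
Proof.
rewrite Rintegral_cst// -[RHS]mulr1; congr (_ * _).
by rewrite -[RHS]/(fine (1 : \bar R)%E); congr fine; exact: probability_setT.
Qed.

Lemma expectD f g : summable_rv f -> summable_rv g ->
  \int[P]_t (f t + g t) = \int[P]_t f t + \int[P]_t g t.
Proof. by move=> hf hg; rewrite RintegralD. Qed.

Lemma expectB f g : summable_rv f -> summable_rv g ->
  \int[P]_t (f t - g t) = \int[P]_t f t - \int[P]_t g t.
Proof. by move=> hf hg; rewrite RintegralB. Qed.

Lemma expectZ c f : summable_rv f -> \int[P]_t (c * f t) = c * \int[P]_t f t.
Proof. by move=> hf; rewrite RintegralZl. Qed.

Lemma expect_sum I (r : seq I) (F : I -> T -> R) :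
  (forall i, summable_rv (F i)) ->
  \int[P]_t (\sum_(i <- r) F i t) = \sum_(i <- r) \int[P]_t F i t.
Proof.
move=> iF; elim: r => [|i r IH].
  by rewrite big_nil -[RHS]expect_cst; apply: eq_Rintegral => t _; rewrite big_nil.
rewrite big_cons -IH -expectD//; last exact: summable_sum.
by apply: eq_Rintegral => t _; rewrite big_cons.
Qed.

Lemma le_expect f g : summable_rv f -> summable_rv g -> (forall t, f t <= g t) ->
  \int[P]_t f t <= \int[P]_t g t.
Proof. by move=> hf hg fg; apply: le_Rintegral. Qed.

Lemma norm_expect_le f g : summable_rv f -> summable_rv g ->
  (forall t, `|f t| <= g t) -> `|\int[P]_t f t| <= \int[P]_t g t.
Proof.
move=> hf hg fg; apply: (le_trans (le_normr_Rintegral _ _)) => //.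
by apply: le_expect => //; exact: summable_norm.
Qed.

Lemma expectE f : summable_rv f -> (\int[P]_t (f t)%:E = (\int[P]_t f t)%R%:E)%E.
Proof. by move=> hf; rewrite /Rintegral fineK//; exact: integrable_fin_num. Qed.

Lemma expect_indic (A : set T) : measurable A ->
  \int[P]_t (\1_A t : R) = fine (P A).
Proof. by move=> mA; rewrite /Rintegral integral_indic// setIT. Qed.

Lemma eq_expect_ae f g : measurable_fun setT f -> measurable_fun setT g ->
  {ae P, forall t, f t = g t} -> \int[P]_t f t = \int[P]_t g t.
Proof.
move=> mf mg fg; rewrite /Rintegral; congr fine.
apply: ae_eq_integral => //; [exact/measurable_EFinP|exact/measurable_EFinP|].
by apply: filterS fg => t e _; rewrite e.
Qed.

Lemma indic_bool (b : T -> bool) t : \1_[set t | b t] t = (b t)%:R :> R.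
Proof. by rewrite indicE; congr (nat_of_bool _)%:R; apply/idP/idP; rewrite inE. Qed.

Lemma probability_ae (A B : set T) : measurable A -> measurable B ->
  {ae P, forall t, A t <-> B t} -> P A = P B.
Proof.
move=> mA mB AB; rewrite -[LHS]fineK ?fin_num_measure//.
rewrite -[RHS]fineK ?fin_num_measure//; congr _%:E; rewrite -!expect_indic//.
apply: eq_expect_ae; [exact: measurable_indic|exact: measurable_indic|].
apply: filterS AB => t [AB BA]; rewrite !indicE; congr (nat_of_bool _)%:R.
by apply/idP/idP; rewrite !inE.
Qed.

Lemma probability1_ae (A : set T) : measurable A -> fine (P A) = 1 ->
  {ae P, forall t, A t}.
Proof.
move=> mA PA; exists (~` A); split; [exact: measurableC| |by []].
apply: etrans (probability_setC P mA) _.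
have -> : P A = 1%E by rewrite -[LHS]fineK ?PA ?fin_num_measure.
by rewrite subee.
Qed.

Lemma expect_cvg_bounded (F : nat -> T -> R) f (c : R) :
  (forall n, measurable_fun setT (F n)) -> measurable_fun setT f ->
  (forall n t, `|F n t| <= c) ->
  {ae P, forall t, F ^~ t @ \oo --> f t} ->
  (fun n => \int[P]_t F n t) @ \oo --> \int[P]_t f t.
Proof.
move=> mF mf Fc Ff.
have mF' n : measurable_fun setT (EFin \o F n) by exact/measurable_EFinP.
have mf' : measurable_fun setT (EFin \o f) by exact/measurable_EFinP.
have Ff' : {ae P, forall t, setT t -> (EFin \o F n) t @[n --> \oo] --> (EFin \o f) t}.
  by apply: filterS Ff => t h _; apply: cvg_EFin => //; exact: nearW.
have Fc' : {ae P, forall t n, setT t -> (`|(EFin \o F n) t| <= (EFin \o cst c) t)%E}.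
  by apply: aeW => t n _; rewrite lee_fin.
have [i _ h] := dominated_convergence measurableT mF' mf' Ff' (summable_cst c) Fc'.
have : (fun n => (\int[P]_t (F n t)%:E)%E) @ \oo --> (\int[P]_t f t)%:E.
  by rewrite -expectE.
by move/fine_cvg.
Qed.

End RealExpectation.

(** * Probabilities of finite trees and removal of invalid parents *)

Section HoppeExpectation.
Context d {T : measurableType d} {R : realType} (P : probability T R) (th : R).
Implicit Types (parent : nat -> T -> nat).

Lemma expect_tree_sum m (F : (nat -> nat) -> T -> R) :
  (forall f, summable_rv P (F f)) ->
  summable_rv P (fun t => tree_sum m (F ^~ t)) /\
  \int[P]_t tree_sum m (F ^~ t) = tree_sum m (fun f => \int[P]_t F f t).
Proof.
elim: m F => [|m IH] F iF //=.
have [i e] := IH (fun f t => \sum_(j < m.+1) F (upd f m.+1 j) t)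
  (fun f => summable_sum _ (fun j => iF _)).
split=> //; rewrite e; apply: eq_tree_sum => f _.
by rewrite expect_sum.
Qed.

Lemma measurable_parent parent : (forall k j, measurable (parent k @^-1` [set j])) ->
  forall k (A : set nat), measurable (parent k @^-1` A).
Proof.
move=> mp k A; rewrite (_ : _ @^-1` A = \bigcup_(j in A) (parent k @^-1` [set j])).
  exact: bigcup_measurable.
apply/seteqP; split=> [t At|t [j Aj /= e]]; last by rewrite /= e.
by exists (parent k t).
Qed.

Lemma measurable_agree parent : (forall k j, measurable (parent k @^-1` [set j])) ->
  forall m f, measurable [set t | agree m (parent ^~ t) f].
Proof.
move=> mp m f.
rewrite (_ : mkset _ = \bigcap_(k in [set k | (0 < k <= m)%N])
    (parent k @^-1` [set f k])); first exact: bigcap_measurableType.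
by apply/seteqP; split => t /= h; [apply/agreeP|apply/agreeP] => //; exact: h.
Qed.

Lemma summable_agree parent : (forall k j, measurable (parent k @^-1` [set j])) ->
  forall m f (c : R), summable_rv P (fun t => (agree m (parent ^~ t) f)%:R * c).
Proof.
move=> mp m f c.
have mA := measurable_agree mp m f.
apply: (@summable_bounded _ _ _ _ _ `|c|).
  apply: measurable_funM => //; rewrite (_ : (fun _ => _) =
    \1_[set t | agree m (parent ^~ t) f]); first exact: measurable_indic.
  by apply/funext => t; rewrite indic_bool.
move=> t; rewrite normrM; case: agree; rewrite ?normr1 ?mul1r//.
by rewrite normr0 mul0r.
Qed.

Lemma expect_agree parent : hoppe_process P th parent ->
  forall m f (c : R), \int[P]_t ((agree m (parent ^~ t) f)%:R * c) =
  (\prod_(1 <= k < m.+1) hoppe_w th k (f k)) * c.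
Proof.
move=> [mp pp] m f c; have mA := measurable_agree mp m f.
rewrite (_ : (fun t => _) = (fun t => c * \1_[set t | agree m (parent ^~ t) f] t)).
  rewrite expectZ; last first.
    rewrite (_ : \1__ = fun t => (agree m (parent ^~ t) f)%:R * 1).
      exact: summable_agree.
    by apply/funext => t; rewrite indic_bool mulr1.
  rewrite expect_indic// mulrC; congr (_ * _).
  rewrite (_ : mkset _ = [set t | forall k, (1 <= k < m.+1)%N -> parent k t = f k]).
    by rewrite pp.
  by apply/seteqP; split => t /= h; [move/agreeP: h|apply/agreeP].
by apply/funext => t; rewrite indic_bool mulrC.
Qed.

(* A process may choose parents that are not yet inserted, on a null set. *)
Definition clip parent k t := if (parent k t < k)%N then parent k t else 0%N.

Lemma recursive_clip parent t : recursive (clip parent ^~ t).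
Proof. by move=> k k0; rewrite /clip; case: ifP. Qed.

(** The probabilities of the finitely many recursive trees with [m] insertions sum to
    [iter m (grow th)] of the constant 1, which is 1. All other parent choices are therefore
    null. *)
Lemma clip_ae parent : 0 < th -> hoppe_process P th parent ->
  {ae P, forall t, forall k, (0 < k)%N -> clip parent k t = parent k t}.
Proof.
move=> th0 hP; have [mp pp] := hP.
have : {ae P, forall t, forall m : nat,
    (forall k, (0 < k <= m)%N -> (parent k t < k)%N)}.
  apply: ae_foralln => m.
  pose A := [set t | forall k, (0 < k <= m)%N -> (parent k t < k)%N].
  have mA : measurable A.
    rewrite (_ : A = \bigcap_(k in [set k | (0 < k <= m)%N])
      (parent k @^-1` [set i | (i < k)%N])).
      by apply: bigcap_measurableType => k _; exact: measurable_parent.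
    by apply/seteqP; split => t /= h k; exact: h.
  have e : \int[P]_t \1_A t = 1 :> R.
    rewrite -[RHS](@iter_grow_cst _ th m 1 [::])// -tree_sum_weights.
    transitivity (tree_sum m (fun f =>
        \int[P]_t ((agree m (parent ^~ t) f)%:R * 1) : R)).
      have [_ <-] := @expect_tree_sum m (fun f t => (agree m (parent ^~ t) f)%:R * 1)
        (fun f => summable_agree mp m f 1).
      apply: eq_Rintegral => t _; rewrite indicE; have [/set_mem At|nAt] := boolP (t \in A).
        rewrite -[RHS](@eq_tree_sum _ m (fun f => (agree m (clip parent ^~ t) f)%:R * 1)).
          by rewrite (@tree_sum_agree _ m _ (fun=> 1))//; exact: recursive_clip.
        move=> f rf; congr (_%:R * _); congr nat_of_bool; apply/agreeP/agreeP => h k km.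
          by rewrite -h// /clip At.
        by rewrite -h// /clip At.
      rewrite (@tree_sum_notin _ m _ (fun=> 1))//; apply: contrapT => h.
      move/negP: nAt; apply; apply/mem_set => k km; rewrite ltnNge; apply/negP => kp.
      by apply: h; exists k.
    by apply: eq_tree_sum => f _; rewrite expect_agree.
  by apply: (probability1_ae mA); rewrite -expect_indic.
apply: filterS => t h k k0; rewrite /clip (h k)//.
by rewrite k0 leqnn.
Qed.

Lemma hoppe_process_clip parent : 0 < th -> hoppe_process P th parent ->
  hoppe_process P th (clip parent).
Proof.
move=> th0 hP; have [mp pp] := hP.
have mc k j : measurable (clip parent k @^-1` [set j]).
  rewrite (_ : _ @^-1` _ = parent k @^-1` [set i | (if (i < k)%N then i else 0%N) = j]).
    exact: measurable_parent.
  by [].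
split=> // n v; rewrite -pp.
have mset (q : nat -> T -> nat) : (forall k j, measurable (q k @^-1` [set j])) ->
    measurable [set t | forall k, (1 <= k < n)%N -> q k t = v k].
  move=> mq; rewrite (_ : mkset _ = \bigcap_(k in [set k | (1 <= k < n)%N])
    (q k @^-1` [set v k])); first exact: bigcap_measurableType.
  by [].
apply: probability_ae; [exact: mset|exact: mset|].
apply: filterS (clip_ae th0 hP) => t e; split => h k kn; rewrite -h//.
  by rewrite e//; case/andP: kn.
by rewrite e//; case/andP: kn.
Qed.

End HoppeExpectation.

(** * Expectations of functionals of the depth list *)

Section HoppeRecursive.
Context d {T : measurableType d} {R : realType} (P : probability T R) (th : R).
Context (parent : nat -> T -> nat) (hP : hoppe_process P th parent)
  (rP : forall t, recursive (parent ^~ t)).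

Lemma depths_tree_sum m (G : seq nat -> R) t : G (depths (parent ^~ t) m) =
  tree_sum m (fun f => (agree m (parent ^~ t) f)%:R * G (depths f m)).
Proof.
rewrite (@tree_sum_agree _ m _ (fun f => G (depths f m)))// => f g rf rg fg.
by rewrite (depths_local rf fg).
Qed.

Lemma summable_depths m (G : seq nat -> R) :
  summable_rv P (fun t => G (depths (parent ^~ t) m)).
Proof.
rewrite (_ : (fun _ => _) = (fun t => tree_sum m
    (fun f => (agree m (parent ^~ t) f)%:R * G (depths f m)))).
  have mp := hP.1.
  by have [] := expect_tree_sum m (fun f => summable_agree P mp m f (G (depths f m))).
by apply/funext => t; exact: depths_tree_sum.
Qed.

Lemma measurable_depths m (G : seq nat -> R) :
  measurable_fun setT (fun t => G (depths (parent ^~ t) m)).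
Proof. exact/summable_measurable/summable_depths. Qed.

Lemma expect_depths m (G : seq nat -> R) :
  \int[P]_t G (depths (parent ^~ t) m) = iter m (grow th) G [::].
Proof.
rewrite (_ : (fun _ => _) = (fun t => tree_sum m
    (fun f => (agree m (parent ^~ t) f)%:R * G (depths f m)))); last first.
  by apply/funext => t; exact: depths_tree_sum.
have [_ ->] := expect_tree_sum m
  (fun f => summable_agree P hP.1 m f (G (depths f m))).
rewrite -tree_sum_weights; apply: eq_tree_sum => f _.
exact: expect_agree.
Qed.

End HoppeRecursive.

(** * From the martingale to the normalised path length *)

Section Normalisation.
Context {R : realType} (th : R).
Hypothesis th0 : 0 < th.

(** For [n = m.+1] nodes, [ipl_scale] and [ipl_shift] are the deterministic coefficients of the
    affine map from the martingale to [norm_ipl]. *)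
Definition ipl_scale m : R := (th + m%:R) / m.+1%:R.
Definition ipl_shift m : R := ipl_scale m * harm th m - ln m.+1%:R.

Lemma ipl_scale_cvg : ipl_scale @ \oo --> (1 : R).
Proof.
rewrite (_ : ipl_scale = (fun m => 1 + (th - 1) * harmonic m)).
  rewrite -[X in _ --> X]addr0; apply: cvgD; first exact: cvg_cst.
  rewrite -(mulr0 (th - 1)); apply: cvgMr; exact: cvg_harmonic.
by apply/funext => m; rewrite /ipl_scale /= -natr1; field; rewrite natr1.
Qed.

Lemma harm_mean_cvg0 : (fun m => harm th m * harmonic m) @ \oo --> (0 : R).
Proof.
pose u : R ^nat := fun j => (th + j.+1%:R)^-1.
have u0 : u @ \oo --> (0 : R).
  apply: (@squeeze_cvgr _ _ _ _ (fun=> 0) harmonic).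
  - apply: nearW => j; rewrite /u /= invr_ge0 ltW/= ?weight_gt0//.
    by rewrite lef_pV2 ?posrE ?weight_gt0// lerDr ltW.
  - exact: cvg_cst.
  - exact: cvg_harmonic.
have := cesaro u0; apply: (@squeeze_cvgr _ _ _ _ (fun=> 0)); last exact: cvg_cst.
apply: nearW => m; rewrite mulr_ge0 ?harm_ge0//=.
rewrite mulrC /arithmetic_mean/= ler_wpM2l// /series/= big_mkord.
by rewrite -/(harm th m.+1) harmS lerDl invr_ge0 ltW// weight_gt0.
Qed.

Lemma harm_sub_ln_cvg : cvgn (fun m => harm th m - ln (m.+1%:R : R)).
Proof.
(* [a] tends to Euler's constant from below, and [b] is the effect of [th] on the harmonic sum. Both
   are increasing and bounded. *)
pose a m : R := \sum_(j < m) j.+1%:R^-1 - ln m.+1%:R.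
pose b m : R := \sum_(j < m) (j.+1%:R^-1 - (th + j.+1%:R)^-1).
rewrite (_ : (fun _ => _) = (fun m => a m - b m)); last first.
  by apply/funext => m; rewrite /a /b /harm sumrB; ring.
have lnS m : ln (m.+2%:R : R) - ln m.+1%:R = ln (1 + m.+1%:R^-1).
  rewrite -ln_div ?posrE//; congr ln; rewrite -[m.+2%:R]natr1.
  by field.
have aS m : a m.+1 = a m + (m.+1%:R^-1 - (ln m.+2%:R - ln m.+1%:R)).
  by rewrite /a big_ord_recr/=; ring.
apply: is_cvgB.
  apply: nondecreasing_is_cvgn.
    apply/nondecreasing_seqP => m.
    rewrite aS lerDl; have := @le_ln1Dx R m.+1%:R^-1; rewrite -lnS => h.
    have x0 : 0 < m.+1%:R^-1 :> R by rewrite invr_gt0.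
    by rewrite subr_ge0; exact: h (lt_trans (ltrN10 _) x0).
  (* The sharper bound is stable under induction: one step adds at most [1 / m.+1 - 1 / m.+2]. *)
  exists 1 => _ [m _ <-]; apply: (@le_trans _ _ (1 - m.+1%:R^-1)); last first.
    by rewrite lerBlDr lerDl invr_ge0.
  elim: m => [|m]; first by rewrite /a big_ord0 ln1 subrr invr1 subrr.
  rewrite aS => IH.
  have x0 : 0 < m.+1%:R^-1 :> R by rewrite invr_gt0.
  have : ln (m.+1%:R / m.+2%:R : R) <= - m.+2%:R^-1.
    rewrite (_ : _ / _ = 1 + - m.+2%:R^-1); last first.
      have : 1 <= m.+1%:R :> R by rewrite ler1n.
      by rewrite -[m.+2%:R]natr1; move: (m.+1%:R) => x x1; field; lra.
    apply: le_ln1Dx; rewrite ltrN2 invf_lt1//; by rewrite ltr1n.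
  rewrite ln_div ?posrE//; move: (a m) IH (ln _) (ln _) => am IH l1 l2.
  by move: x0 IH; move: (m.+1%:R^-1) (m.+2%:R^-1) => y z; lra.
apply: nondecreasing_is_cvgn.
  apply/nondecreasing_seqP => m; rewrite /b big_ord_recr/= lerDl subr_ge0.
  by rewrite lef_pV2 ?posrE ?weight_gt0// lerDr ltW.
exists (2 * th) => _ [m _ <-].
(* With [x = m.+1] the summand is [th / (x (x + th))], at most [2 th / (x (x + 1))] since [x >= 1],
   and the latter telescopes. *)
apply: (@le_trans _ _ (2 * th - 2 * th / m.+1%:R)); last first.
  by rewrite lerBlDr lerDl mulr_ge0 ?invr_ge0// mulr_ge0// ltW.
elim: m => [|m]; first by rewrite /b big_ord0 invr1 mulr1 subrr.
rewrite /b big_ord_recr/= -[m.+2%:R]natr1; set x : R := m.+1%:R => IH.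
have x1 : 1 <= x by rewrite ler1n.
have t0 := th0.
apply: (le_trans (lerD IH (lexx _))); rewrite -subr_ge0.
rewrite (_ : _ - _ = th * (x + 2 * th - 1) / (x * (x + 1) * (x + th))).
  have ? : 0 <= th * (x + 2 * th - 1) by apply: mulr_ge0; lra.
  by apply: divr_ge0 => //; apply: mulr_ge0; [apply: mulr_ge0|]; lra.
by field; apply/and3P; split; lra.
Qed.

Lemma ipl_shift_cvg : cvgn ipl_shift.
Proof.
rewrite (_ : ipl_shift = (fun m => (th - 1) * (harm th m * harmonic m) +
    (harm th m - ln (m.+1%:R : R)))).
  apply: is_cvgD; last exact: harm_sub_ln_cvg.
  by apply: is_cvgMr; apply/cvg_ex; exists 0; exact: harm_mean_cvg0.
apply/funext => m; rewrite /ipl_shift /ipl_scale/= -natr1; field.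
by rewrite natr1.
Qed.

Lemma norm_ipl_mart {T : Type} (parent : nat -> T -> nat) m t :
  norm_ipl parent m.+1 t =
  ipl_scale m * ipl_mart th (depths (parent ^~ t) m) + ipl_shift m :> R.
Proof.
rewrite /norm_ipl ipl_depths /ipl_shift /ipl_scale /ipl_mart size_depths.
have W0 := weight_gt0 m th0; rewrite -natr1; set k : R := m%:R in W0 *.
by field; rewrite /k natr1 pnatr_eq0/= gt_eqF.
Qed.

End Normalisation.

(** * Sequences of extended reals *)

Section ErealSequences.
Context {R : realType}.

Lemma cvg_EFin_seq (u : R ^nat) (l : R) : u @ \oo --> l ->
  (fun k => (u k)%:E) @ \oo --> l%:E.
Proof. by move=> ul; apply: cvg_EFin => //; exact: nearW. Qed.

Lemma limn_einf_le_cvg (u v : (\bar R) ^nat) (l : \bar R) :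
  (forall k, (u k <= v k)%E) -> v @ \oo --> l -> (limn_einf u <= l)%E.
Proof.
move=> uv vl; rewrite limn_einf_lim -(cvg_lim _ vl)//.
apply: lee_lim; [exact: is_cvg_einfs|by apply/cvg_ex; exists l|].
apply: nearW => k; apply: le_trans (uv k).
by apply: ereal_inf_lbound; exists k => /=.
Qed.

Lemma measurable_fun_limn_einf d (T : measurableType d)
    (f : (T -> \bar R) ^nat) : (forall n, measurable_fun setT (f n)) ->
  measurable_fun setT (fun x => limn_einf (f ^~ x)).
Proof.
move=> mf; rewrite (_ : (fun _ => _) =
    (fun x => - limn_esup ((fun n y => - f n y) ^~ x))%E); last first.
  apply/funext => x; rewrite -limn_einfN; congr limn_einf.
  by apply/funext => n /=; rewrite oppeK.
apply: measurableT_comp => //; apply: measurable_fun_limn_esup => n.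
exact: measurableT_comp.
Qed.

End ErealSequences.

(** * Almost sure and L2 limit, non-degeneracy *)

Section HoppeLimit.
Context d {T : measurableType d} {R : realType} (P : probability T R) (th : R).
Context (parent : nat -> T -> nat) (th0 : 0 < th)
  (hP : hoppe_process P th parent) (rP : forall t, recursive (parent ^~ t)).
Implicit Types (e : R).

Definition mart m t : R := ipl_mart th (depths (parent ^~ t) m).

Lemma measurable_mart m : measurable_fun setT (mart m).
Proof. exact: (measurable_depths hP rP m (ipl_mart th)). Qed.

Lemma summable_mart m : summable_rv P (mart m).
Proof. exact: (summable_depths hP rP m (ipl_mart th)). Qed.

Definition mart_var_lim : R := limn (mart_var th).

Lemma mart_var_le_lim m : mart_var th m <= mart_var_lim.
Proof.
apply: nondecreasing_cvgn_le; first exact: mart_var_nondecreasing.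
exact: mart_var_cvg.
Qed.

Definition far_from i e j : set T :=
  [set t | [exists k : 'I_j.+1, e <= `|mart (i + k) t - mart i t|]].

(** [far] looks back from time [i + j] and [far_from] looks forward from time [i], so the index is
    reversed. *)
Lemma far_fromE i e j t : far_from i e j t =
  far th (ipl_mart th (drop j (depths (parent ^~ t) (i + j)))) e j
    (depths (parent ^~ t) (i + j)).
Proof.
rewrite /far_from /far/= drop_depths; congr is_true.
have dropE (k : 'I_j.+1) :
    drop k (depths (parent ^~ t) (i + j)) = depths (parent ^~ t) (i + (j - k)).
  have kj : (k <= j)%N by rewrite -ltnS.
  have -> : (i + j = i + (j - k) + k)%N by rewrite -addnA subnK.
  exact: drop_depths.
apply/existsP/existsP => -[k]; rewrite /mart => ek; exists (rev_ord k).
  by rewrite dropE /= subSS subKn// -ltnS.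
by move: ek; rewrite dropE /= subSS.
Qed.

Lemma measurable_far_from i e j : measurable (far_from i e j).
Proof.
have := measurable_depths hP rP (i + j) (fun u => (far th (ipl_mart th (drop j u)) e j u)%:R).
move=> /(_ measurableT [set 1] (measurable_set1 _)); rewrite setTI.
set A := (X in measurable X); rewrite (_ : far_from _ _ _ = A)//.
apply/seteqP; split => t; rewrite far_fromE /A/=; first by move=> ->.
by case: far => // /eqP; rewrite eq_sym oner_eq0.
Qed.

Lemma far_from_le i e j : 0 < e ->
  fine (P (far_from i e j)) <= (mart_var_lim - mart_var th i) / e ^+ 2.
Proof.
move=> e0; rewrite -expect_indic; last exact: measurable_far_from.
rewrite (_ : \int[P]_t _ = \int[P]_t
  (fun u => (far th (ipl_mart th (drop j u)) e j u)%:R)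
     (depths (parent ^~ t) (i + j))); last first.
  apply: eq_Rintegral => t _; rewrite indicE; congr (nat_of_bool _)%:R.
  by apply/idP/idP; rewrite inE far_fromE.
rewrite (expect_depths hP rP (i + j)
  (fun u => (far th (ipl_mart th (drop j u)) e j u)%:R)); apply: (le_trans (iter_far_increment_le i j th0 e0)).
by rewrite ler_wpM2r ?invr_ge0 ?sqr_ge0// lerD2r mart_var_le_lim.
Qed.

(** Continuity from below in [j] extends the maximal inequality to the whole future of [i]; the
    remaining variance after time [i] tends to 0. *)
Lemma far_from_negligible e : 0 < e ->
  P.-negligible (\bigcap_i \bigcup_j far_from i e j).
Proof.
move=> e0; set A := \bigcap_i _.
have mB i : measurable (\bigcup_j far_from i e j).
  by apply: bigcupT_measurable => j; exact: measurable_far_from.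
have mA : measurable A by apply: bigcapT_measurable.
have PB i : (P (\bigcup_j far_from i e j) <=
    ((mart_var_lim - mart_var th i) / e ^+ 2)%:E)%E.
  have cv : (P \o far_from i e) @ \oo --> P (\bigcup_j far_from i e j).
    apply: nondecreasing_cvg_mu => //; first by move=> j; exact: measurable_far_from.
    apply/nondecreasing_seqP => j; apply/subsetPset => t /existsP[k ek].
    by apply/existsP; exists (widen_ord (leqnSn _) k).
  rewrite -(cvg_lim _ cv)//; apply: lime_le; first by apply/cvg_ex; eexists; exact: cv.
  apply: nearW => j /=; rewrite -[leLHS]fineK ?fin_num_measure//; last exact: measurable_far_from.
  by rewrite lee_fin far_from_le.
exists A; split => //; apply/eqP; rewrite eq_le measure_ge0 andbT.
have PA i : (P A <= ((mart_var_lim - mart_var th i) / e ^+ 2)%:E)%E.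
  apply: (le_trans _ (PB i)); apply: le_measure; rewrite ?inE//.
  exact: bigcap_inf.
have fA : P A \is a fin_num by exact: fin_num_measure.
rewrite -(fineK fA) lee_fin.
have cv : (fun i => (mart_var_lim - mart_var th i) / e ^+ 2) @ \oo --> (0 : R).
  have -> : 0 = (mart_var_lim - mart_var_lim) / e ^+ 2 by rewrite subrr mul0r.
  apply: cvgMl; apply: cvgB; [exact: cvg_cst|exact: mart_var_cvg].
rewrite -(cvg_lim _ cv)//; apply: limr_ge; first by apply/cvg_ex; exists 0; exact: cv.
by apply: nearW => i; rewrite -lee_fin fineK.
Qed.

Lemma mart_cvg_ae : {ae P, forall t, cvgn (mart ^~ t)}.
Proof.
have : P.-negligible (\bigcup_n (\bigcap_i \bigcup_j far_from i n.+1%:R^-1 j)).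
  by apply: negligible_bigcup => n; apply: far_from_negligible; rewrite invr_gt0.
apply: negligibleS => t; apply: contra_notP => nt.
apply: cauchy_cvg; apply: cauchy_exP => e e0.
pose n := Num.truncn e^-1.
have ne : n.+1%:R^-1 < e.
  rewrite -[ltRHS]invrK ltf_pV2 ?posrE ?invr_gt0//.
  by have := truncnS_gt e^-1.
have /existsNP[i /not_implyP[_ ni]] :
    ~ (forall i, setT i -> (\bigcup_j far_from i n.+1%:R^-1 j) t).
  by move=> h; apply: nt; exists n.
exists (mart i t); exists i => // k /= ik.
rewrite -ball_normE/= distrC; apply: lt_trans ne.
rewrite ltNge; apply/negP => h; apply: ni; exists (k - i)%N => //.
by apply/existsP; exists ord_max; rewrite /= subnKC.
Qed.

Lemma expect_mart m : \int[P]_t mart m t = 0.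
Proof.
rewrite (expect_depths hP rP m (ipl_mart th)) iter_grow_fix//.
  by rewrite /ipl_mart/= mul0r /harm big_ord0 subrr.
by move=> u; exact: grow_ipl_mart.
Qed.

Lemma summable_mart2 m : summable_rv P (fun t => mart m t ^+ 2).
Proof. exact: (summable_depths hP rP m (fun u => ipl_mart th u ^+ 2)). Qed.

Lemma expect_mart2 m : \int[P]_t (mart m t ^+ 2) = mart_var th m.
Proof. exact: (expect_depths hP rP m (fun u => ipl_mart th u ^+ 2)). Qed.

Lemma mart_incrE i j t : (mart (i + j) t - mart i t) ^+ 2 =
  (fun u => (ipl_mart th u - ipl_mart th (drop j u)) ^+ 2)
    (depths (parent ^~ t) (i + j)).
Proof. by rewrite /= drop_depths. Qed.

Lemma summable_mart_incr i j :
  summable_rv P (fun t => (mart (i + j) t - mart i t) ^+ 2).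
Proof.
under eq_fun do rewrite mart_incrE.
exact: (summable_depths hP rP (i + j)
  (fun u => (ipl_mart th u - ipl_mart th (drop j u)) ^+ 2)).
Qed.

Lemma expect_mart_incr i j : \int[P]_t ((mart (i + j) t - mart i t) ^+ 2) =
  mart_var th (i + j) - mart_var th i.
Proof.
under eq_Rintegral do rewrite mart_incrE.
rewrite (expect_depths hP rP (i + j)
  (fun u => (ipl_mart th u - ipl_mart th (drop j u)) ^+ 2)).
exact: mart_var_increment.
Qed.

Lemma measurable_norm_ipl m : measurable_fun setT (norm_ipl parent m.+1 : T -> R).
Proof.
rewrite (_ : norm_ipl _ _ = fun t => ipl_scale th m * mart m t + ipl_shift th m).
  by apply: measurable_funD => //; apply: measurable_funM => //; exact: measurable_mart.
by apply/funext => t; exact: norm_ipl_mart.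
Qed.

(** A limit superior is measurable everywhere, and it is the limit off the null set where the paths
    diverge. *)
Definition ipl_limit t : R :=
  fine (limn_esup (fun m => (norm_ipl parent m.+1 t : R)%:E)).

Lemma measurable_ipl_limit : measurable_fun setT ipl_limit.
Proof.
apply: (measurableT_comp (fine_measurable measurableT)).
apply: measurable_fun_limn_esup => m.
by apply/measurable_EFinP; exact: measurable_norm_ipl.
Qed.

Lemma ipl_limit_cvg_ae :
  {ae P, forall t, norm_ipl parent n t @[n --> \oo] --> ipl_limit t}.
Proof.
apply: filterS mart_cvg_ae => t ct.
have c : cvgn (fun m => norm_ipl parent m.+1 t : R).
  rewrite (_ : (fun _ => _) = fun m => ipl_scale th m * mart m t + ipl_shift th m).
    apply: is_cvgD; last exact: ipl_shift_cvg.
    apply: is_cvgM => //; apply/cvg_ex; exists 1; exact: ipl_scale_cvg.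
  by apply/funext => m; exact: norm_ipl_mart.
rewrite -cvg_shiftS /ipl_limit.
have /cvg_ex[l cl] := c.
by rewrite (cvg_limn_einf_sup (cvg_EFin_seq cl)).2.
Qed.

(** The limit in [k] of [incr_bound m k]: the difference of two normalised path lengths is a
    martingale increment, a change of scale and a change of shift, and the square of a sum of three
    terms is at most 3 times the sum of their squares. *)
Definition l2_bound m : R := 3 * ((mart_var_lim - mart_var th m) +
  (ipl_scale th m - 1) ^+ 2 * mart_var th m +
  (ipl_shift th m - limn (ipl_shift th)) ^+ 2).

Lemma l2_bound_cvg0 : l2_bound @ \oo --> (0 : R).
Proof.
have -> : (0 : R) = 3 * ((mart_var_lim - mart_var_lim) +
    (1 - 1) ^+ 2 * mart_var_lim +
    (limn (ipl_shift th) - limn (ipl_shift th)) ^+ 2) by ring.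
apply: cvgMr; apply: cvgD; first apply: cvgD.
- by apply: cvgB; [exact: cvg_cst|exact: mart_var_cvg].
- apply: cvgM; last exact: mart_var_cvg.
  apply: cvgM; apply: cvgB; (exact: ipl_scale_cvg || exact: cvg_cst).
- by apply: cvgM; apply: cvgB; (exact: ipl_shift_cvg || exact: cvg_cst).
Qed.

Let incr_bound m k : R :=
  3 * (ipl_scale th (m + k) ^+ 2 * (mart_var th (m + k) - mart_var th m) +
  (ipl_scale th m - ipl_scale th (m + k)) ^+ 2 * mart_var th m +
  (ipl_shift th m - ipl_shift th (m + k)) ^+ 2).

Lemma incr_bound_cvg m : incr_bound m @ \oo --> l2_bound m.
Proof.
have sh (u : R ^nat) (l : R) : u @ \oo --> l -> (fun k => u (m + k)%N) @ \oo --> l.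
  by move=> h; under eq_fun do rewrite addnC; rewrite -(cvg_shiftn m) in h.
rewrite (_ : l2_bound m = 3 * (1 ^+ 2 * (mart_var_lim - mart_var th m) +
  (ipl_scale th m - 1) ^+ 2 * mart_var th m +
  (ipl_shift th m - limn (ipl_shift th)) ^+ 2)); last by rewrite expr1n mul1r.
apply: cvgMr; apply: cvgD; first apply: cvgD.
- apply: cvgM.
    by apply: cvgM; apply: sh; exact: ipl_scale_cvg.
  by apply: cvgB; [apply: sh; exact: mart_var_cvg|exact: cvg_cst].
- apply: cvgMl; apply: cvgM; apply: cvgB;
    (exact: cvg_cst || (apply: sh; exact: ipl_scale_cvg)).
- by apply: cvgM; apply: cvgB; (exact: cvg_cst || (apply: sh; exact: ipl_shift_cvg)).
Qed.

Lemma expect_norm_ipl_incr m k :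
  (\int[P]_t (((norm_ipl parent m.+1 t : R) - norm_ipl parent (m + k).+1 t) ^+ 2)%:E
   <= (incr_bound m k)%:E)%E.
Proof.
pose F t : R := 3 * (ipl_scale th (m + k) ^+ 2 * (mart (m + k) t - mart m t) ^+ 2 +
  (ipl_scale th m - ipl_scale th (m + k)) ^+ 2 * mart m t ^+ 2 +
  (ipl_shift th m - ipl_shift th (m + k)) ^+ 2).
have iF1 := summableZ (ipl_scale th (m + k) ^+ 2) (summable_mart_incr m k).
have iF2 := summableZ ((ipl_scale th m - ipl_scale th (m + k)) ^+ 2) (summable_mart2 m).
have iF3 := summable_cst P ((ipl_shift th m - ipl_shift th (m + k)) ^+ 2).
have iF12 := summableD iF1 iF2; have iF123 := summableD iF12 iF3.
have iF : summable_rv P F by exact: summableZ.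
have -> : incr_bound m k = \int[P]_t F t.
  rewrite expectZ// expectD// expectD// expectZ; last exact: summable_mart_incr.
  rewrite expectZ; last exact: summable_mart2.
  by rewrite expect_cst expect_mart_incr expect_mart2.
rewrite -expectE//; apply: ge0_le_integral => //.
- by move=> t _; rewrite lee_fin sqr_ge0.
- by apply/measurable_EFinP; apply: measurable_funX; apply: measurable_funB;
    exact: measurable_norm_ipl.
- by apply/measurable_EFinP; exact: summable_measurable iF.
move=> t _; rewrite lee_fin !(@norm_ipl_mart _ th)// /F -!/(mart _ t).
move: (ipl_scale th m) (ipl_scale th (m + k)) (ipl_shift th m) (ipl_shift th (m + k)).
move: (mart m t) (mart (m + k) t) => x y a b c e.
(* With [u = b (y - x)], [v = (a - b) x] and [w = c - e], the left square is [(v + w - u) ^+ 2], and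
   the gap to 3 times the sum of squares is itself a sum of squares. *)
rewrite -subr_ge0 (_ : _ - _ = (b * (y - x) + (a - b) * x) ^+ 2 +
  (b * (y - x) + (c - e)) ^+ 2 + ((a - b) * x - (c - e)) ^+ 2); last by ring.
by rewrite !addr_ge0// sqr_ge0.
Qed.

(** Fatou's lemma in [k] applied to the squared increments from [m] to [m + k]. *)
Lemma l2_bound_ipl (X : T -> R) m : measurable_fun setT X ->
  {ae P, forall t, norm_ipl parent n t @[n --> \oo] --> X t} ->
  (\int[P]_t (((norm_ipl parent m.+1 t : R) - X t) ^+ 2)%:E
   <= (l2_bound m)%:E)%E.
Proof.
move=> mX cX.
pose f k t : \bar R :=
  ((norm_ipl parent m.+1 t - norm_ipl parent (m + k).+1 t) ^+ 2)%:E.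
have mf k : measurable_fun setT (f k).
  by apply/measurable_EFinP; apply: measurable_funX; apply: measurable_funB;
    exact: measurable_norm_ipl.
have f0 k t : setT t -> (0 <= f k t)%E by rewrite lee_fin sqr_ge0.
have le : (limn_einf (fun k => \int[P]_t f k t) <= (l2_bound m)%:E)%E.
  apply: (limn_einf_le_cvg (expect_norm_ipl_incr m)).
  exact: cvg_EFin_seq (@incr_bound_cvg m).
apply: (le_trans _ le); apply: (le_trans _ (fatou P measurableT mf f0)).
rewrite le_eqVlt; apply/orP; left; apply/eqP; apply: ae_eq_integral => //.
- by apply/measurable_EFinP; apply: measurable_funX; apply: measurable_funB => //;
    exact: measurable_norm_ipl.
- exact: measurable_fun_limn_einf.
apply: filterS cX => t ct _; apply/esym.
apply: (cvg_limn_einf_sup _).1; apply: cvg_EFin_seq.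
have {}ct : norm_ipl parent (m + k).+1 t @[k --> \oo] --> X t.
  rewrite -cvg_shiftS -(cvg_shiftn m) in ct.
  by under eq_fun do rewrite addnC.
by apply: cvgM; apply: cvgB => //; exact: cvg_cst.
Qed.

Section LimitVariable.
Context (X : T -> R) (mX : measurable_fun setT X)
  (cX : {ae P, forall t, norm_ipl parent n t @[n --> \oo] --> X t}).

Lemma measurable_ipl_error m :
  measurable_fun setT (fun t => (norm_ipl parent m.+1 t : R) - X t).
Proof. by apply: measurable_funB => //; exact: measurable_norm_ipl. Qed.

Lemma summable_ipl_error2 m :
  summable_rv P (fun t => ((norm_ipl parent m.+1 t : R) - X t) ^+ 2).
Proof.
apply/integrableP; split.
  by apply/measurable_EFinP; apply: measurable_funX; exact: measurable_ipl_error.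
under eq_integral do rewrite /= ger0_norm ?sqr_ge0//.
by apply: (le_lt_trans (l2_bound_ipl m mX cX)); rewrite ltry.
Qed.

Lemma summable_ipl_error m :
  summable_rv P (fun t => (norm_ipl parent m.+1 t : R) - X t).
Proof.
apply: (@le_summable _ _ _ _ _
  (fun t => 1 + ((norm_ipl parent m.+1 t : R) - X t) ^+ 2)).
- exact: measurable_ipl_error.
- by apply: summableD; [exact: summable_cst|exact: summable_ipl_error2].
move=> t; move: (_ - _) => z.
by rewrite -(real_normK (num_real z)); have := normr_ge0 z; nra.
Qed.

(** Hence the error at [m = 0] is [- X], and integrability of the error gives that of the limit. *)
Lemma norm_ipl1 t : norm_ipl parent 1 t = 0 :> R.
Proof.
by rewrite /norm_ipl ipl_depths/= ln1 mulr0 subrr mul0r.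
Qed.

Lemma summable_ipl_limit2 : summable_rv P (fun t => X t ^+ 2).
Proof.
have := summable_ipl_error2 0; congr (summable_rv P _).
by apply/funext => t; rewrite norm_ipl1 sub0r sqrrN.
Qed.

Lemma summable_ipl_limit : summable_rv P X.
Proof.
have := summableZ (-1) (summable_ipl_error 0); congr (summable_rv P _).
by apply/funext => t; rewrite norm_ipl1 sub0r mulN1r opprK.
Qed.

Lemma expect_ipl_error2_cvg0 :
  (\int[P]_t ((norm_ipl parent n t - X t) ^+ 2)%:E)%E @[n --> \oo] --> 0%E.
Proof.
rewrite -cvg_shiftS.
suff : (fun m => (\int[P]_t ((norm_ipl parent m.+1 t - X t) ^+ 2)%:E)%E) @ \oo
    --> (0%:E : \bar R) by [].
apply: (@squeeze_cvge _ _ _ _ (fun=> 0%E) _ (fun m => (l2_bound m)%:E)).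
- apply: nearW => m; rewrite l2_bound_ipl// andbT.
  by apply: integral_ge0 => t _; rewrite lee_fin sqr_ge0.
- exact: cvg_cst.
- by apply: cvg_EFin_seq; exact: l2_bound_cvg0.
Qed.

Lemma expect_ipl_error_cvg0 :
  (\int[P]_t `|(norm_ipl parent m.+1 t : R) - X t|) @[m --> \oo] --> (0 : R).
Proof.
apply: (@squeeze_cvgr _ _ _ _ (fun=> 0) (fun m => Num.sqrt (l2_bound m))).
- apply: nearW => m; apply/andP; split; first by apply: Rintegral_ge0.
  set E1 := \int[P]_t _; have E0 : 0 <= E1 by apply: Rintegral_ge0.
  rewrite -[leLHS](ger0_norm E0) -sqrtr_sqr ler_wsqrtr//.
  have iZ := summable_norm (summable_ipl_error m).
  apply: (@le_trans _ _ (\int[P]_t ((norm_ipl parent m.+1 t - X t) ^+ 2))); last first.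
    by rewrite -lee_fin -expectE; [exact: l2_bound_ipl|exact: summable_ipl_error2].
  (* Cauchy-Schwarz, in the form that the variance of the absolute error is nonnegative. *)
  have : 0 <= \int[P]_t (((norm_ipl parent m.+1 t - X t) ^+ 2 +
      (- 2 * E1) * `|norm_ipl parent m.+1 t - X t|) + E1 ^+ 2).
    apply: Rintegral_ge0 => t _; rewrite -(real_normK (num_real (_ - _))).
    by have := sqr_ge0 (`|norm_ipl parent m.+1 t - X t| - E1); nra.
  have i1 := summable_ipl_error2 m; have i2 := summableZ (- 2 * E1) iZ.
  rewrite expectD; [|exact: summableD i1 i2|exact: summable_cst].
  by rewrite expectD// expectZ// expect_cst -/E1; nra.
- exact: cvg_cst.
- rewrite -[X in _ --> X](sqrtr0 R); apply: continuous_cvg.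
    exact: sqrt_continuous.
  exact: l2_bound_cvg0.
Qed.

(** If the limit were constant, the squared L2 error would be at least [ipl_scale ^+ 2] times
    [mart_var th 2], which stays away from 0, yet it is below [l2_bound]. *)
Lemma ipl_limit_nondegenerate : ~ (exists c : R, {ae P, forall t, X t = c}).
Proof.
move=> [c Xc].
have le m : (2 <= m)%N -> ipl_scale th m ^+ 2 * mart_var th 2 <= l2_bound m.
  move=> m2; have ic := summable_cst P ((ipl_shift th m - c) ^+ 2).
  have i2 := summableZ (ipl_scale th m ^+ 2) (summable_mart2 m).
  have i1 := summableZ (2 * (ipl_scale th m * (ipl_shift th m - c))) (summable_mart m).
  have i12 := summableD i2 i1; have i12c := summableD i12 ic.
  rewrite -lee_fin; apply: le_trans (l2_bound_ipl m mX cX).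
  rewrite (@ae_eq_integral _ _ _ _ _ (fun t => (ipl_scale th m ^+ 2 * mart m t ^+ 2 +
    2 * (ipl_scale th m * (ipl_shift th m - c)) * mart m t +
    (ipl_shift th m - c) ^+ 2)%:E))//; last 3 first.
  - by apply/measurable_EFinP; apply: measurable_funX; exact: measurable_ipl_error.
  - by apply/measurable_EFinP; exact: summable_measurable i12c.
  - apply: filterS Xc => t -> _; rewrite (@norm_ipl_mart _ th)// -/(mart m t).
    by congr EFin; ring.
  rewrite expectE// lee_fin expectD// expectD// expectZ; last exact: summable_mart2.
  rewrite expectZ; last exact: summable_mart.
  rewrite expect_mart expect_mart2 expect_cst mulr0 addr0.
  rewrite -[leLHS]addr0 lerD ?sqr_ge0// ler_wpM2l ?sqr_ge0//.
  exact: mart_var_nondecreasing.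
have c1 : (fun m => ipl_scale th m ^+ 2 * mart_var th 2) @ \oo -->
    (1 ^+ 2 * mart_var th 2).
  by apply: cvgM; [apply: cvgM; exact: ipl_scale_cvg|exact: cvg_cst].
have := mart_var2_gt0 th0; apply/negP; rewrite -leNgt.
rewrite -[leLHS]mul1r -[X in X * _](expr1n R 2) -(cvg_lim _ c1)//.
rewrite -(cvg_lim _ l2_bound_cvg0)//; apply: ler_lim.
- by apply/cvg_ex; eexists; exact: c1.
- by apply/cvg_ex; eexists; exact: l2_bound_cvg0.
- by exists 2 => // m /= m2; exact: le.
Qed.

End LimitVariable.

End HoppeLimit.

(** * Splitting at the first child: urn and Bernstein operators *)

Section FirstChild.
Context {R : realType}.
Implicit Types (th : R) (G : seq nat -> R) (Psi : seq nat -> seq nat -> R).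

(** Joining two trees loses the order of insertion, so the splitting applies to functionals that
    ignore it, such as those of the path length. *)
Definition perm_inv G := forall s s', perm_eq s s' -> G s = G s'.

Lemma perm_inv_grow th G : perm_inv G -> perm_inv (grow th G).
Proof.
move=> iG s s' ss'; rewrite /grow (perm_size ss') (perm_big _ ss')/=.
congr ((_ * _ + _) / _); first by apply: iG; rewrite perm_cons.
by apply: eq_bigr => d _; apply: iG; rewrite perm_cons.
Qed.

(* [a] collects the depths outside the subtree of the first child of the root,
   [b] the depths inside it, relative to that child. *)
Definition grow2 th Psi a b : R :=
  ((th + (size a)%:R) * grow th (Psi ^~ b) a +
   (1 + (size b)%:R) * grow 1 (Psi a) b) / (th + 1 + (size a)%:R + (size b)%:R).

(** The entry 1 is the first child itself, which is missing from [b] just as the root is from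
    [a]. *)
Definition join_trees a b : seq nat := a ++ 1%N :: map S b.

Lemma perm_join_trees a c x : perm_eq (x :: a ++ 1%N :: c) (a ++ 1%N :: x :: c).
Proof.
apply/permP => p; rewrite /= !count_cat/= addnCA; congr (_ + _)%N.
exact: addnCA.
Qed.

(** The root with [a] has weight [th + size a]; the first child has weight 1, so with [b] it forms a
    tree that grows with parameter 1. *)
Lemma grow_join th G a b : 0 < th -> perm_inv G ->
  grow th G (join_trees a b) = grow2 th (fun x y => G (join_trees x y)) a b.
Proof.
move=> th0 iG; rewrite /grow2 /grow.
have Wa := weight_gt0 (size a) th0.
have Wb : 0 < (1 : R) + (size b)%:R by exact: weight_gt0.
rewrite !mulrA ![_ * (_ + _) / _]mulrAC !divff ?gt_eqF// !mul1r.
rewrite /join_trees big_cat/= big_cons big_map.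
congr (_ / _); last first.
  rewrite size_cat/= size_map natrD -natr1.
  by move: (size a)%:R (size b)%:R => x y; ring.
rewrite -!addrA; congr (_ + (_ + (_ + _))).
  exact/iG/perm_join_trees.
by apply: eq_bigr => d _; exact/iG/perm_join_trees.
Qed.

Lemma perm_inv_iter_grow th m G : perm_inv G -> perm_inv (iter m (grow th) G).
Proof. by move=> iG; elim: m => [//|m IH]; exact: perm_inv_grow. Qed.

Lemma eq_grow2 th Psi Psi' a b : (forall x y, Psi x y = Psi' x y) ->
  grow2 th Psi a b = grow2 th Psi' a b.
Proof.
by move=> e; rewrite /grow2; congr ((_ * _ + _ * _) / _); apply: eq_grow => d.
Qed.

Lemma iter_grow_join th m G a b : 0 < th -> perm_inv G ->
  iter m (grow th) G (join_trees a b) =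
  iter m (grow2 th) (fun x y => G (join_trees x y)) a b.
Proof.
move=> th0 iG; elim: m a b => [//|m IH] a b /=.
rewrite grow_join//; last exact: perm_inv_iter_grow.
by apply: eq_grow2.
Qed.

Lemma grow_sum th (I : Type) (r : seq I) (F : I -> seq nat -> R) s :
  grow th (fun u => \sum_(i <- r) F i u) s = \sum_(i <- r) grow th (F i) s.
Proof.
elim: r => [|i r IH].
  rewrite big_nil (@eq_grow _ th _ (fun=> 0 * 0 + 0 * 0)); last first.
    by move=> d; rewrite big_nil; ring.
  by rewrite (grow_linear _ 0 0 (fun=> 0) (fun=> 0)) !mul0r addr0.
rewrite big_cons -IH -[grow th (F i) s]mul1r -[X in _ + X]mul1r -grow_linear.
by apply: eq_grow => d; rewrite big_cons !mul1r.
Qed.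

Lemma grow_swap th th' Psi a b :
  grow th' (fun y => grow th (Psi ^~ y) a) b =
  grow th (fun x => grow th' (Psi x) b) a.
Proof.
rewrite {1}/grow -grow_sum.
set w := (th' + _)^-1.
transitivity (grow th (fun x => (w * th') * Psi x (1%N :: b) +
    w * (\sum_(d <- b) Psi x (d.+1 :: b))) a).
  by rewrite grow_linear; ring.
by apply: eq_grow => d; rewrite /grow -/w; ring.
Qed.

Lemma grow_iter_swap th th' j Psi a b :
  grow th' (fun y => iter j (grow th) (Psi ^~ y) a) b =
  iter j (grow th) (fun x => grow th' (Psi x) b) a.
Proof.
elim: j a => [//|j IH] a /=.
rewrite (grow_swap th th' (fun x y => iter j (grow th) (Psi ^~ y) x)).
by apply: eq_grow => d; exact: IH.
Qed.

(* Expectation of [phi] of the number of draws of the second colour in [m]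
   draws from a Polya urn with initial masses [th + al] and [1 + ka]. *)
Fixpoint urn th m (al ka : nat) (phi : nat -> R) : R :=
  if m is m'.+1 then
    ((th + al%:R) * urn th m' al.+1 ka phi +
     (1 + ka%:R) * urn th m' al ka.+1 (fun k => phi k.+1)) /
    (th + 1 + al%:R + ka%:R)
  else phi 0%N.

Lemma eq_urn th m al ka phi phi' : (forall k, (k <= m)%N -> phi k = phi' k) ->
  urn th m al ka phi = urn th m al ka phi'.
Proof.
elim: m al ka phi phi' => [|m IH] al ka phi phi' e /=; first exact: e.
rewrite (IH _ _ _ phi'); last by move=> k km; apply: e; rewrite leqW.
by rewrite (IH al ka.+1 _ (fun k => phi' k.+1))// => k km; exact: e.
Qed.

Lemma grow_urn th th' m al ka (F : nat -> seq nat -> R) s :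
  grow th' (fun u => urn th m al ka (F ^~ u)) s =
  urn th m al ka (fun k => grow th' (F k) s).
Proof.
elim: m al ka F => [//|m IH] al ka F /=.
rewrite -IH -(IH al ka.+1 (fun k => F k.+1)).
set w := (th + 1 + _ + _)^-1; rewrite mulrDl !(mulrAC _ _ w) -grow_linear.
by apply: eq_grow => d; rewrite -!(mulrAC _ _ w) -mulrDl.
Qed.

(** The urn sees the two trees only through their sizes. Given its draws, insertions into different
    trees commute by [grow_iter_swap], so only the number [k] of insertions into the second tree
    matters. *)
Lemma iter_grow2 th m Psi a b : 0 < th -> iter m (grow2 th) Psi a b =
  urn th m (size a) (size b) (fun k =>
    iter (m - k) (grow th) (fun x => iter k (grow 1) (Psi x) b) a).
Proof.
move=> th0; elim: m a b => [//|m IH] a b.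
rewrite iterS /=; rewrite /grow2; congr ((_ * _ + _ * _) / _).
  rewrite (@eq_grow _ th _ (fun u => urn th m (size a).+1 (size b) (fun k =>
    iter (m - k) (grow th) (fun x => iter k (grow 1) (Psi x) b) u))); last first.
    by move=> d; rewrite IH.
  rewrite (grow_urn th th m _ _ (fun k u =>
    iter (m - k) (grow th) (fun x => iter k (grow 1) (Psi x) b) u)).
  by apply: eq_urn => k km; rewrite subSn.
rewrite (@eq_grow _ 1 _ (fun u => urn th m (size a) (size b).+1 (fun k =>
    iter (m - k) (grow th) (fun x => iter k (grow 1) (Psi x) u) a))); last first.
  by move=> d; rewrite IH.
rewrite (grow_urn th 1 m _ _ (fun k u =>
    iter (m - k) (grow th) (fun x => iter k (grow 1) (Psi x) u) a)).
apply: eq_urn => k km; rewrite subSS.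
exact: (grow_iter_swap th 1 (m - k) (fun x y => iter k (grow 1) (Psi x) y)).
Qed.

Lemma sumn_join a b : sumn (join_trees a b) = (sumn a + sumn b + (size b).+1)%N.
Proof.
rewrite /join_trees sumn_cat/= add1n -addnA; congr (_ + _)%N.
elim: b => [//|d b IH] /=.
by rewrite addSn -addnS IH addnA !addnS.
Qed.

(** The summand [k.+1] arises because each of the [k.+1] nodes of the subtree lies one level deeper
    in the whole tree. *)
Lemma ipl_first_child th m (phi : nat -> R) : 0 < th ->
  iter m.+1 (grow th) (fun s => phi (sumn s)) [::] =
  urn th m 0 0 (fun k => iter (m - k) (grow th) (fun a => iter k (grow 1)
    (fun b => phi (sumn a + sumn b + k.+1)%N) [::]) [::]).
Proof.
move=> th0; have iG m' : perm_inv (iter m' (grow th) (fun s => phi (sumn s))).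
  by apply: perm_inv_iter_grow => s s' ss'; rewrite !sumnE (perm_big _ ss').
(* The first insertion is forced and leaves two single nodes; [m] random draws remain. *)
rewrite iterS {1}/grow big_nil addr0/= addr0 mulrAC divff ?gt_eqF// mul1r.
rewrite -[[:: 1%N]]/(join_trees [::] [::]) iter_grow_join//; last exact: (iG 0%N).
rewrite iter_grow2//; apply: eq_urn => k _.
apply: eq_iter_grow => a _; apply: eq_iter_grow => b bk.
by rewrite sumn_join size_cat bk addn0.
Qed.

(** Expectation of [phi] of a binomial variable with parameters [m] and [b], conditioned on the
    first trial so as to parallel [urn]. *)
Fixpoint bern m (b : R) (phi : nat -> R) : R :=
  if m is m'.+1 then (1 - b) * bern m' b phi + b * bern m' b (fun k => phi k.+1)
  else phi 0%N.

Lemma eq_bern m b phi phi' : (forall k, (k <= m)%N -> phi k = phi' k) ->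
  bern m b phi = bern m b phi'.
Proof.
elim: m phi phi' => [|m IH] phi phi' e /=; first exact: e.
rewrite (IH phi phi'); last by move=> k km; apply: e; rewrite leqW.
congr (_ + _ * _); apply: IH => k km; exact: e.
Qed.

Lemma bern_linear m b (x y : R) phi psi :
  bern m b (fun k => x * phi k + y * psi k) = x * bern m b phi + y * bern m b psi.
Proof. by elim: m phi psi => [//|m IH] phi psi /=; rewrite !IH; ring. Qed.

Lemma bern_cst m (b c : R) : bern m b (fun=> c) = c.
Proof. by elim: m => [//|m IH] /=; rewrite IH; ring. Qed.

Lemma le_bern m (b : R) phi psi : 0 <= b <= 1 ->
  (forall k, (k <= m)%N -> phi k <= psi k) -> bern m b phi <= bern m b psi.
Proof.
move=> /andP[b0 b1]; elim: m phi psi => [|m IH] phi psi e /=; first exact: e.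
rewrite lerD// ler_wpM2l ?subr_ge0// IH// => k km; apply: e => //.
exact: leqW.
Qed.

(** The offset [j] absorbs a success in the first trial and so carries the induction. *)
Lemma bern_sqr m (b x : R) j : bern m b (fun k => ((k + j)%:R - x) ^+ 2) =
  (j%:R + m%:R * b - x) ^+ 2 + m%:R * b * (1 - b).
Proof.
elim: m j => [|m IH] j /=; first by rewrite add0n; ring.
rewrite IH; under [X in _ + b * X]eq_bern => k _ do rewrite addSnnS.
by rewrite IH -!natr1; ring.
Qed.

End FirstChild.

(** * Integration against a density *)

Section Density.
Context d (T : measurableType d) (R : realType).
Variables (nu : {finite_measure set T -> \bar R})
  (mu : {sigma_finite_measure set T -> \bar R}) (g : T -> \bar R).
Hypotheses (mg : measurable_fun setT g) (nug : forall A, measurable A -> nu A = (\int[mu]_(x in A) g x)%E).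

(** [g] agrees almost everywhere with the Radon-Nikodym derivative of [nu], to which the change of
    variables applies. *)
Lemma integral_density f : nu.-integrable setT f ->
  (\int[nu]_x f x = \int[mu]_x (f x * g x))%E.
Proof.
move=> fi; have dom : nu `<< mu.
  apply/null_content_dominatesP => A mA muA.
  by rewrite nug// null_set_integral//; exact: measurable_funTS.
rewrite -(Radon_Nikodym_change_of_variables dom)//.
apply: ae_eq_integral => //.
- apply: emeasurable_funM; first exact: measurable_int fi.
  by apply: (measurable_int mu); exact: Radon_Nikodym_integrable.
- by apply: emeasurable_funM => //; exact: measurable_int fi.
- apply: ae_eqe_mul2l; apply: integral_ae_eq => //.
  + exact: Radon_Nikodym_integrable.
  + move=> E _ mE; rewrite -nug//.
    by rewrite -Radon_Nikodym_integral.
Qed.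

End Density.

(** * A recursion for the beta moments *)

Section BetaMoments.
Context d {T : measurableType d} {R : realType} (Q : probability T R) (th : R).
Context (B : T -> R) (th0 : 0 < th) (mB : measurable_fun setT B)
  (B01 : forall t, 0 < B t < 1) (lB : beta1_distributed Q th B).
Local Notation mu := (@lebesgue_measure R).

Let mB_mixin := isMeasurableFun.Build _ _ T (measurableTypeR R) B mB.
Let BRV : {RV Q >-> measurableTypeR R} := HB.pack B mB_mixin.

Let dens (x : R) : \bar R :=
  ((fun y => (th * powR (1 - y) (th - 1))%:E) \_ `[0, 1]) x.

Let measurable_dens : measurable_fun setT dens.
Proof.
apply/(measurable_restrictT _ _).1 => //.
apply: measurable_funTS; apply/measurable_EFinP; apply: measurable_funM => //.
apply: (measurableT_comp (measurable_powR _)).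
exact: measurable_funB.
Qed.

Lemma expect_beta (phi : R -> R) (c : R) : measurable_fun setT phi ->
  (forall t, `|phi (B t)| <= c) ->
  \int[Q]_t phi (B t) = \int[mu]_(x in `[0, 1]) (phi x * (th * powR (1 - x) (th - 1))).
Proof.
move=> mphi phic; rewrite /Rintegral; congr fine.
have ip : (distribution Q BRV).-integrable setT (EFin \o phi : measurableTypeR R -> _).
  apply: integrable_pushforward => //; first exact/measurable_EFinP.
  by apply: (@summable_bounded _ _ _ Q _ c) => //; exact: measurableT_comp.
transitivity (\int[distribution Q BRV]_x (phi x)%:E)%E.
  rewrite integral_distribution//; first exact/measurable_EFinP.
  by apply: (@summable_bounded _ _ _ Q _ c) => //; exact: measurableT_comp.
transitivity (\int[mu]_x ((phi x)%:E * dens x))%E; last first.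
  rewrite [RHS]integral_mkcond; apply: eq_integral => x _.
  by rewrite /dens /patch; case: ifP => _; rewrite ?mule0.
apply: (@integral_density _ (measurableTypeR R) R (distribution Q BRV) mu dens) => //.
move=> A mA; apply: etrans (lB mA) _; rewrite /dens -integral_mkcondr.
by rewrite set_itvcc.
Qed.

Lemma powRDn (x c : R) n : 0 < x -> x ^+ n * powR x c = powR x (n%:R + c).
Proof.
move=> x0; rewrite powRD ?powR_mulrn ?ltW//.
by apply/implyP => _; rewrite gt_eqF.
Qed.

Definition beta_mom ka al : R := \int[Q]_t (B t ^+ ka * (1 - B t) ^+ al).

Lemma beta_poly_le1 ka al t : `|B t ^+ ka * (1 - B t) ^+ al| <= 1.
Proof.
have /andP[b0 b1] := B01 t; rewrite ger0_norm.
  rewrite mulr_ile1 ?exprn_ge0 ?exprn_ile1 ?subr_ge0 ?ltW//.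
  by rewrite ltrBlDr ltrDl.
by rewrite mulr_ge0 ?exprn_ge0 ?subr_ge0 ?ltW.
Qed.

Lemma measurable_beta_poly ka al :
  measurable_fun setT (fun x : R => x ^+ ka * (1 - x) ^+ al).
Proof.
apply: measurable_funM; apply: measurable_funX => //.
exact: measurable_funB.
Qed.

Lemma summable_beta_poly ka al :
  summable_rv Q (fun t => B t ^+ ka * (1 - B t) ^+ al).
Proof.
apply: (@summable_bounded _ _ _ _ _ 1); last exact: beta_poly_le1.
exact: (measurableT_comp (measurable_beta_poly ka al) mB).
Qed.

(** The mean of [psi] is the difference of the two sides of the moment recursion, and [psi] times
    the density is the derivative of [primitive]. *)
Let psi ka al (x : R) : R := ka.+1%:R * (x ^+ ka * (1 - x) ^+ al.+1) -
  (th + al%:R) * (x ^+ ka.+1 * (1 - x) ^+ al).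

Let psi_bound ka al t : `|psi ka al (B t)| <= ka.+1%:R + (th + al%:R).
Proof.
apply: (le_trans (ler_normB _ _)); rewrite !normrM -!normrM.
have c0 : 0 <= th + al%:R by rewrite ltW// weight_gt0.
apply: lerD; rewrite normrM ger0_norm// -[leRHS]mulr1 ler_wpM2l//;
  exact: beta_poly_le1.
Qed.

Let measurable_psi ka al : measurable_fun setT (psi ka al).
Proof.
by apply: measurable_funB; apply: measurable_funM => //;
  exact: measurable_beta_poly.
Qed.

Lemma is_derive_powR_onem (c y : R) : y < 1 ->
  is_derive y 1 (fun y => powR (1 - y) c) (- (c * powR (1 - y) (c - 1))).
Proof.
move=> y1; have y0 : 0 < 1 - y by rewrite subr_gt0.
have h1 := is_derive1_powR c y0.
have h2 : is_derive y 1 (fun y : R => 1 - y) (0 - 1).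
  by apply: is_deriveB.
have := @is_derive1_comp R (fun y => powR y c) (fun y => 1 - y) y _ _ h1 h2.
by rewrite sub0r mulrN1.
Qed.

Lemma continuous_powR_onem (c y : R) : y < 1 ->
  {for y, continuous (fun y : R => powR (1 - y) c)}.
Proof.
move=> y1; have [dF _] := is_derive_powR_onem c y1.
exact/differentiable_continuous/derivable1_diffP.
Qed.

Let primitive ka al (y : R) : R := th * (y ^+ ka.+1 * powR (1 - y) (th + al%:R)).

Let is_derive_primitive ka al (y : R) : y < 1 ->
  is_derive y 1 (primitive ka al) (psi ka al y * (th * powR (1 - y) (th - 1))).
Proof.
move=> y1; have y0 : 0 < 1 - y by rewrite subr_gt0.
have h1 := is_derive_powR_onem (th + al%:R) y1.
have h2 : is_derive y 1 (fun y : R => y ^+ ka.+1) (ka.+1%:R * y ^+ ka).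
  have := is_deriveX ka.+1 (is_derive_id y (1 : R)).
  by rewrite /GRing.scale/= mulr1 exprfctE.
have h3 := is_deriveM h2 h1; have h4 := is_deriveZ th h3.
apply: is_derive_eq h4 _.
rewrite /psi /GRing.scale/=.
have e1 : powR (1 - y) (th + al%:R) = (1 - y) ^+ al.+1 * powR (1 - y) (th - 1).
  by rewrite powRDn//; congr powR; rewrite -natr1; ring.
have e2 : powR (1 - y) (th + al%:R - 1) = (1 - y) ^+ al * powR (1 - y) (th - 1).
  by rewrite powRDn//; congr powR; ring.
by rewrite e1 e2; ring.
Qed.

Let continuous_primitive ka al (y : R) : y < 1 -> {for y, continuous (primitive ka al)}.
Proof.
move=> y1; have [dF _] := is_derive_primitive ka al y1.
exact/differentiable_continuous/derivable1_diffP.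
Qed.

(** For [th < 1] the density is unbounded at 1, so the fundamental theorem of calculus is applied on
    [[0, x]] only. *)
Let expect_psi_trunc ka al (x : R) : 0 < x < 1 ->
  \int[Q]_t (psi ka al (B t) * \1_(`]-oo, x]%classic) (B t)) =
  th * (x ^+ ka.+1 * powR (1 - x) (th + al%:R)).
Proof.
move=> /andP[x0 x1].
rewrite (@expect_beta (fun y => psi ka al y * \1_(`]-oo, x]%classic) y)
  (ka.+1%:R + (th + al%:R))); last first.
- move=> t; rewrite indicE; case: (_ \in _); first by rewrite mulr1 psi_bound.
  by rewrite mulr0 normr0 addr_ge0// ltW// weight_gt0.
- by apply: measurable_funM => //; exact: measurable_indic.
pose f (y : R) := psi ka al y * (th * powR (1 - y) (th - 1)).
transitivity (\int[mu]_(y in `[0, x]) f y).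
  rewrite Rintegral_mkcond [RHS]Rintegral_mkcond; apply: eq_Rintegral => y _.
  rewrite /patch indicE !mem_setE !in_itv/= /f.
  have [y0|] := boolP (0 <= y) => //=.
  have [yx|yx] := boolP (y <= x); last by rewrite mulr0 mul0r; case: ifP.
  by rewrite (le_trans yx (ltW x1)) mulr1.
rewrite /Rintegral (@continuous_FTC2 _ f (primitive ka al))//.
- by rewrite -EFinB/= /primitive expr0n/= mul0r mulr0 subr0.
- apply: continuous_in_subspaceT => y; rewrite inE/= in_itv/= => /andP[_ yx].
  have y1 := le_lt_trans yx x1.
  apply: cvgM.
    apply: cvgB; apply: cvgM; try exact: cvg_cst.
      apply: cvgM; first exact: exprn_continuous.
      apply: (@cvg_comp _ _ _ (fun z : R => 1 - z) (fun z => z ^+ al.+1)); last exact: exprn_continuous.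
      by apply: cvgB => //; exact: cvg_cst.
    apply: cvgM; first exact: exprn_continuous.
    apply: (@cvg_comp _ _ _ (fun z : R => 1 - z) (fun z => z ^+ al)); last exact: exprn_continuous.
    by apply: cvgB => //; exact: cvg_cst.
  by apply: cvgM; [exact: cvg_cst|exact: continuous_powR_onem].
- split.
  + move=> y; rewrite in_itv/= => /andP[_ yx].
    by have [] := is_derive_primitive ka al (lt_trans yx x1).
  + by apply: cvg_at_right_filter; exact: continuous_primitive.
  + by apply: cvg_at_left_filter; exact: continuous_primitive.
- move=> y; rewrite in_itv/= => /andP[_ yx].
  by rewrite derive1E; have [_ ->] := is_derive_primitive ka al (lt_trans yx x1).
Qed.

Lemma beta_mom_rec ka al :
  (th + al%:R) * beta_mom ka.+1 al = (1 + ka%:R) * beta_mom ka al.+1.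
Proof.
have c0 : 0 < th + al%:R by exact: weight_gt0.
set c := th + al%:R in c0 *.
have ipsi : summable_rv Q (fun t => psi ka al (B t)).
  apply: (@summable_bounded _ _ _ _ _ (ka.+1%:R + c)); last exact: psi_bound.
  exact: (measurableT_comp (measurable_psi ka al) mB).
suff e : \int[Q]_t psi ka al (B t) = 0.
  apply/esym/eqP; rewrite -subr_eq0 -e /beta_mom nat1r -!expectZ;
    try exact: summable_beta_poly.
  by rewrite -expectB//; apply: summableZ; exact: summable_beta_poly.
(* Chosen so that [powR (u n) c] is [1 / n.+2]: truncating at [1 - u n] leaves a boundary term below
   [th * harmonic n]. *)
pose u n : R := powR n.+2%:R^-1 c^-1.
have u01 n : 0 < u n < 1.
  rewrite /u powR_gt0 ?invr_gt0//=.
  have : powR n.+2%:R^-1 c^-1 < powR 1 c^-1.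
    apply: gt0_ltr_powR; rewrite ?invr_gt0 ?nnegrE ?invr_ge0//.
    by rewrite invf_lt1// ltr1n.
  by move/lt_le_trans; apply; rewrite powR1.
have cv1 : (fun n => \int[Q]_t (psi ka al (B t) * \1_(`]-oo, 1 - u n]%classic) (B t)))
    @ \oo --> \int[Q]_t psi ka al (B t).
  apply: (@expect_cvg_bounded _ _ _ _ _ _ (ka.+1%:R + c)).
  - move=> n; apply: measurable_funM.
      exact: (measurableT_comp (measurable_psi ka al) mB).
    apply: (measurableT_comp _ mB); exact: measurable_indic.
  - exact: (measurableT_comp (measurable_psi ka al) mB).
  - move=> n t; rewrite indicE; case: (_ \in _); first by rewrite mulr1 psi_bound.
    by rewrite mulr0 normr0 addr_ge0// ltW.
  - apply: aeW => t; apply: cvg_near_cst.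
    have /andP[B0 B1] := B01 t.
    have p0 : 0 < powR (1 - B t) c by rewrite powR_gt0// subr_gt0.
    have : \forall n \near \oo, (harmonic n : R) <= powR (1 - B t) c.
      by apply: (cvgr_le (0 : R)) => //; exact: cvg_harmonic.
    apply: filterS => n hn; rewrite indicE mem_set ?mulr1//=.
    rewrite in_itv/= lerBrDl -lerBrDr -[leRHS](_ : powR (powR (1 - B t) c) c^-1 = _).
      apply: ge0_ler_powR; rewrite ?nnegrE ?invr_ge0 ?ltW//.
      apply: lt_le_trans hn; rewrite /= ltf_pV2 ?posrE// ltr_nat//.
    by rewrite -powRrM mulfV ?gt_eqF// powRr1// subr_ge0 ltW.
have cv2 : (fun n => \int[Q]_t (psi ka al (B t) * \1_(`]-oo, 1 - u n]%classic) (B t)))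
    @ \oo --> (0 : R).
  apply: (@squeeze_cvgr _ _ _ _ (fun=> 0) (fun n => th * harmonic n)).
  - apply: nearW => n; have /andP[u0 u1] := u01 n.
    rewrite expect_psi_trunc; last by rewrite subr_gt0 u1 ltrBlDr ltrDl u0.
    rewrite opprB addrCA subrr addr0 -/c /u -powRrM mulVf ?gt_eqF// powRr1 ?invr_ge0//.
    rewrite mulr_ge0 ?mulr_ge0 ?exprn_ge0 ?invr_ge0 ?subr_ge0 ?ltW//=.
    rewrite ltr_pM2l// -[ltRHS]mul1r; apply: (@le_lt_trans _ _ (1 * n.+2%:R^-1)).
      rewrite ler_wpM2r ?invr_ge0// exprn_ile1// ?subr_ge0 ?(ltW u1)//.
    by rewrite !mul1r ltf_pV2 ?posrE// ltr_nat.
  - exact: cvg_cst.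
  - by rewrite -[X in _ --> X](mulr0 th); apply: cvgM; [exact: cvg_cst|exact: cvg_harmonic].
by rewrite -(cvg_lim _ cv1)// (cvg_lim _ cv2).
Qed.

End BetaMoments.

(** * The urn as a beta mixture of binomials *)

Section UrnBeta.
Context d {T : measurableType d} {R : realType} (Q : probability T R) (th : R).
Context (B : T -> R) (th0 : 0 < th) (mB : measurable_fun setT B)
  (B01 : forall t, 0 < B t < 1) (lB : beta1_distributed Q th B).

Lemma beta_momD ka al : beta_mom Q B ka al = beta_mom Q B ka al.+1 + beta_mom Q B ka.+1 al.
Proof.
rewrite /beta_mom -expectD; try exact: (summable_beta_poly Q mB B01).
by apply: eq_Rintegral => t _; rewrite !exprS; ring.
Qed.

Lemma measurable_bern m (phi : nat -> R) :
  measurable_fun setT (fun b : R => bern m b phi).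
Proof.
elim: m phi => [|m IH] phi //=.
apply: measurable_funD; apply: measurable_funM => //.
exact: measurable_funB.
Qed.

Lemma bern_bounded m (b c : R) (phi : nat -> R) : 0 <= b <= 1 ->
  (forall k, (k <= m)%N -> `|phi k| <= c) -> `|bern m b phi| <= c.
Proof.
move=> b01 phic; rewrite ler_norml -{1}(bern_cst m b (- c)) -{2}(bern_cst m b c).
by apply/andP; split; apply: le_bern => // k km;
  have := phic k km; rewrite ler_norml => /andP[].
Qed.

Lemma summable_bern_poly m ka al (phi : nat -> R) :
  summable_rv Q (fun t => B t ^+ ka * (1 - B t) ^+ al * bern m (B t) phi).
Proof.
apply: (@summable_bounded _ _ _ _ _ (\sum_(k < m.+1) `|phi k|)).
  apply: measurable_funM.
    exact: (measurableT_comp (measurable_beta_poly ka al) mB).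
  exact: (measurableT_comp (measurable_bern m phi) mB).
move=> t; rewrite normrM -[leRHS]mul1r ler_pM//; first exact: (beta_poly_le1 B01).
apply: bern_bounded => [|k km].
  by have /andP[b0 b1] := B01 t; rewrite !ltW.
rewrite -ltnS in km; rewrite (bigD1 (Ordinal km))//= lerDl.
by apply: sumr_ge0.
Qed.

(** By [beta_momD] and [beta_mom_rec], the moment at [(ka, al)] splits into those at [(ka, al.+1)]
    and [(ka.+1, al)] in the ratio [th + al] to [1 + ka]. These are the odds of the next draw, so
    urn and mixture obey the same recursion. *)
Lemma urn_beta m ka al (phi : nat -> R) :
  beta_mom Q B ka al * urn th m al ka phi =
  \int[Q]_t (B t ^+ ka * (1 - B t) ^+ al * bern m (B t) phi).
Proof.
elim: m ka al phi => [|m IH] ka al phi /=.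
  rewrite mulrC -expectZ; last exact: (summable_beta_poly Q mB B01).
  by apply: eq_Rintegral => t _; rewrite mulrC.
have W0 : 0 < th + 1 + al%:R + ka%:R.
  by rewrite -!addrA ltr_pwDl// !addr_ge0.
have H := beta_mom_rec th0 mB B01 lB ka al.
transitivity (beta_mom Q B ka al.+1 * urn th m al.+1 ka phi +
  beta_mom Q B ka.+1 al * urn th m al ka.+1 (fun k => phi k.+1)).
  rewrite (beta_momD ka al) mulrA; apply: (canLR (mulfK _)); first by rewrite gt_eqF.
  move: (urn _ _ _ _ _) (urn _ _ _ _ _) (beta_mom _ _ _ _) (beta_mom _ _ _ _) H.
  move=> u v m2 m1 /eqP; rewrite -subr_eq0 => /eqP e.
  apply/eqP; rewrite -subr_eq0; apply/eqP.
  transitivity (((th + al%:R) * m1 - (1 + ka%:R) * m2) * (v - u)); first by ring.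
  by rewrite e mul0r.
rewrite !IH -expectD; try exact: summable_bern_poly.
by apply: eq_Rintegral => t _; rewrite !exprS; ring.
Qed.

Lemma urn_bern m (phi : nat -> R) :
  urn th m 0 0 phi = \int[Q]_t bern m (B t) phi.
Proof.
have := urn_beta m 0 0 phi.
rewrite /beta_mom; under eq_Rintegral do rewrite !expr0 mulr1.
rewrite expect_cst mul1r => ->; apply: eq_Rintegral => t _.
by rewrite !expr0 !mul1r.
Qed.

End UrnBeta.

(** * Convergence of Bernstein operators and weighted errors *)

Section Bernstein.
Context {R : realType}.

(** [k.+1 / m.+2] is the share of the subtree among [m.+2] nodes. Scaled by [m.+2 ^+ 2], its mean
    squared deviation is [(1 - 2 b) ^+ 2 + m b (1 - b)]: squared bias plus binomial variance. *)
Lemma bern_sqr_le m (b : R) : 0 <= b <= 1 ->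
  bern m b (fun k => (k.+1%:R / m.+2%:R - b) ^+ 2) <= m.+2%:R^-1.
Proof.
move=> /andP[b0 b1].
rewrite (@eq_bern _ m b _ (fun k => (m.+2%:R ^- 2) * ((k + 1)%:R - m.+2%:R * b) ^+ 2
  + 0 * 0)); last first.
  move=> k _; rewrite addn1 mul0r addr0.
  have : m.+2%:R != 0 :> R by rewrite pnatr_eq0.
  by move: (m.+2%:R) => n n0; field.
rewrite (bern_linear m b _ 0 _ (fun=> 0)) bern_sqr mul0r addr0.
rewrite ler_pdivrMl ?exprn_gt0//.
rewrite [leRHS](_ : _ = m.+2%:R); last by rewrite expr2 mulfK// pnatr_eq0.
rewrite -[m.+2%:R]natr1 -[m.+1%:R]natr1; have : 0 <= m%:R :> R by [].
by move: (m%:R) => x x0; nra.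
Qed.

Lemma bern_cvg (H : R -> R) (c b : R) : 0 < b < 1 -> (forall x, `|H x| <= c) ->
  {for b, continuous H} ->
  (fun m => bern m b (fun k => H (k.+1%:R / m.+2%:R))) @ \oo --> H b.
Proof.
move=> /andP[b0 b1] Hc cH; have b01 : 0 <= b <= 1 by rewrite !ltW.
apply/cvgrPdist_le => e e0.
have e2 : 0 < e / 2 by rewrite divr_gt0.
have [dl /= dl0 Hdl] : exists2 dl : R, 0 < dl &
    forall x, `|x - b| < dl -> `|H x - H b| <= e / 2.
  have /cvgrPdist_le /(_ _ e2) [dl /= dl0 h] := cH.
  by exists dl => // x xb; rewrite distrC; apply: h; rewrite /= distrC.
have c0 : 0 <= c by exact: le_trans (normr_ge0 (H 0)) (Hc 0).
(* Beyond distance [dl] the trivial bound [2 c] is dominated by [C] times the squared distance, as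
   in Chebyshev's inequality. *)
pose C := 2 * c / dl ^+ 2.
have C0 : 0 <= C by rewrite divr_ge0 ?sqr_ge0// mulr_ge0.
have Hq x : `|H x - H b| <= e / 2 + C * (x - b) ^+ 2.
  have [xb|xb] := ltP `|x - b| dl.
    by rewrite (le_trans (Hdl _ xb))// lerDl mulr_ge0 ?sqr_ge0.
  apply: (@le_trans _ _ (2 * c)).
    by rewrite (le_trans (ler_normB _ _))// mulr_natl mulr2n lerD.
  rewrite -[leLHS]add0r lerD ?(ltW e2)// /C mulrAC ler_pdivlMr ?exprn_gt0//.
  rewrite ler_wpM2l ?mulr_ge0// -(real_normK (num_real (x - b))).
  by rewrite lerXn2r// nnegrE ltW.
have : \forall m \near \oo, C * harmonic m <= e / 2.
  apply: (cvgr_le (0 : R)) => //; rewrite -[X in _ --> X](mulr0 C).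
  by apply: cvgM; [exact: cvg_cst|exact: cvg_harmonic].
apply: filterS => m hm; rewrite distrC.
rewrite -{1}(bern_cst m b (H b)) -[X in _ - X]mul1r -[X in X - _]mul1r -mulNr.
rewrite -bern_linear; apply: (@le_trans _ _ (e / 2 + C * m.+2%:R^-1)); last first.
  rewrite [leRHS](splitr e) lerD2l (le_trans _ hm)// ler_wpM2l//.
  by rewrite /= lef_pV2 ?posrE// ler_nat.
have le k : `|1 * H (k.+1%:R / m.+2%:R) + -1 * H b| <=
    1 * (e / 2) + C * (k.+1%:R / m.+2%:R - b) ^+ 2.
  by rewrite mul1r mulN1r mul1r.
have : bern m b (fun k => 1 * (e / 2) + C * (k.+1%:R / m.+2%:R - b) ^+ 2) <=
    e / 2 + C * m.+2%:R^-1.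
  rewrite (bern_linear m b 1 C (fun=> e / 2)) bern_cst mul1r lerD2l ler_wpM2l//.
  exact: bern_sqr_le.
move=> le2; apply: le_trans le2; rewrite ler_norml; apply/andP; split.
  rewrite -[leLHS]mulN1r -[leLHS]addr0 -[X in _ + X](mul0r 0).
  rewrite -{2}(bern_cst m b 0) -bern_linear; apply: le_bern => // k _.
  by have := le k; rewrite ler_norml => /andP[h _]; rewrite mul0r addr0 [leLHS]mulN1r.
by apply: le_bern => // k _; have := le k; rewrite ler_norml => /andP[].
Qed.

(** A part too small for its error to have decayed carries a small weight [j.+1 / m.+2]; this makes
    the bound uniform in [j]. *)
Lemma weighted_cvg0 (e : R ^nat) (eps : R) : (forall j, 0 <= e j) ->
  e @ \oo --> (0 : R) -> 0 < eps ->
  \forall m \near \oo, forall j, (j <= m)%N -> j.+1%:R / m.+2%:R * e j <= eps.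
Proof.
move=> e_ge0 ce eps0.
have [N _ hN] : \forall j \near \oo, e j <= eps by apply: (cvgr_le (0 : R)).
pose C := \sum_(i < N) e i.
have C0 : 0 <= C by apply: sumr_ge0.
have eC j : (j < N)%N -> e j <= C.
  by move=> jN; rewrite /C (bigD1 (Ordinal jN))//= lerDl sumr_ge0.
have : \forall m \near \oo, (N%:R * C) * harmonic m <= eps.
  apply: (cvgr_le (0 : R)) => //; rewrite -[X in _ --> X](mulr0 (N%:R * C)).
  by apply: cvgM; [exact: cvg_cst|exact: cvg_harmonic].
apply: filterS => m hm j jm; have [jN|Nj] := ltnP j N.
  apply: le_trans hm; rewrite mulrAC ler_pM ?mulr_ge0 ?invr_ge0//.
    by rewrite ler_pM// ?ler_nat// eC.
  by rewrite /= lef_pV2 ?posrE// ler_nat.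
rewrite -[leRHS]mul1r ler_pM ?divr_ge0//; last exact: hN.
by rewrite ler_pdivrMr// mul1r ler_nat ltnW.
Qed.

End Bernstein.

(** * Lipschitz test functions and the toll *)

Section TestFunctions.
Context {R : realType}.

Definition test_fun (K : R) (f : R -> R) : Prop :=
  0 <= K /\ (forall x, 0 <= f x <= 1) /\
  (forall x y, `|f x - f y| <= K * `|x - y|).

Lemma lipschitz_continuous (K : R) (f : R -> R) :
  (forall x y, `|f x - f y| <= K * `|x - y|) -> continuous f.
Proof.
move=> fK x; apply/cvgrPdist_le => e e0.
have K0 : 0 < 1 + `|K| by rewrite ltr_pwDl.
exists (e / (1 + `|K|)) => /=; first by rewrite divr_gt0.
move=> y /=; rewrite ltr_pdivlMr// => /ltW xy.
apply: (le_trans (fK _ _)); apply: le_trans xy; rewrite mulrC ler_wpM2l//.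
by rewrite (le_trans (ler_norm _))// lerDr.
Qed.

Lemma lipschitz_measurable (K : R) (f : R -> R) :
  (forall x y, `|f x - f y| <= K * `|x - y|) -> measurable_fun setT f.
Proof.
by move=> fK; apply: continuous_measurable_fun; exact: lipschitz_continuous fK.
Qed.

Lemma test_norm K f x : test_fun K f -> `|f x| <= 1.
Proof. by move=> [_ [/(_ x)/andP[f0 f1] _]]; rewrite ger0_norm. Qed.

Definition toll (b : R) : R := b * ln b + (1 - b) * ln (1 - b) + b.

Lemma fpe_rhsE (x xt b : R) : fpe_rhs x xt b = (1 - b) * x + b * xt + toll b.
Proof. by rewrite /fpe_rhs /toll !addrA. Qed.

Lemma measurable_toll : measurable_fun setT toll.
Proof.
have mo : measurable_fun setT (fun b : R => 1 - b) by exact: measurable_funB.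
apply: measurable_funD => //; apply: measurable_funD.
  by apply: measurable_funM => //; exact: measurable_ln.
by apply: measurable_funM => //; exact: (measurableT_comp (@measurable_ln R) mo).
Qed.

Lemma continuous_toll b : 0 < b < 1 -> {for b, continuous toll}.
Proof.
move=> /andP[b0 b1].
have co : (fun b : R => 1 - b) @ b --> 1 - b.
  by apply: cvgB => //; exact: cvg_cst.
apply: cvgD => //; apply: cvgD; apply: cvgM => //.
  exact: continuous_ln.
apply: (@cvg_comp _ _ _ (fun b : R => 1 - b) (@ln R)); first exact: co.
by apply: continuous_ln; rewrite subr_gt0.
Qed.

(** At the exact share of the subtree, the toll accounts for the three terms of type [n ln n] and
    for the extra level [b.+1], without error. *)
Lemma fpe_rhs_norm_ipl {T T1 : Type} (parent : nat -> T -> nat)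
    (parent1 : nat -> T1 -> nat) a b t t1 :
  fpe_rhs (norm_ipl parent a.+1 t) (norm_ipl parent1 b.+1 t1)
    (b.+1%:R / (a + b).+2%:R) =
  ((ipl (parent ^~ t) a.+1 + ipl (parent1 ^~ t1) b.+1 + b.+1)%:R -
    (a + b).+2%:R * ln ((a + b).+2%:R : R)) / (a + b).+2%:R.
Proof.
rewrite /fpe_rhs /norm_ipl !natrD.
have e : (a + b).+2%:R = a.+1%:R + b.+1%:R :> R by rewrite -natrD addSn addnS.
have a0 : 0 < a.+1%:R :> R by []. have b0 : 0 < b.+1%:R :> R by [].
have n0 : 0 < (a + b).+2%:R :> R by [].
have -> : 1 - b.+1%:R / (a + b).+2%:R = a.+1%:R / (a + b).+2%:R :> R.
  by rewrite -[X in X - _](divff (lt0r_neq0 n0)) -mulrBl e addrK.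
rewrite !ln_div ?posrE// e.
move: (ln _) (ln _) (ln _) => l1 l2 l3; rewrite e in n0.
move: (a.+1%:R) (b.+1%:R) ((ipl _ _)%:R) ((ipl _ _)%:R) a0 b0 n0.
move=> x y u v x0 y0 xy0.
by field; apply/and3P; split; rewrite gt_eqF.
Qed.

End TestFunctions.

(** * The right-hand side averaged over two independent variables *)

Section DoubleExpectation.
Context d d1 {T : measurableType d} {T1 : measurableType d1} {R : realType}.
Context (P : probability T R) (P1 : probability T1 R) (K : R) (f : R -> R).
Hypothesis hf : test_fun K f.

Let fK : forall x y, `|f x - f y| <= K * `|x - y|. Proof. by case: hf => _ []. Qed.
Let K0 : 0 <= K. Proof. by case: hf. Qed.

Lemma measurable_test_rhs (V : T1 -> R) (u b : R) : measurable_fun setT V ->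
  measurable_fun setT (fun t1 => f (fpe_rhs u (V t1) b)).
Proof.
move=> mV; apply: (measurableT_comp (lipschitz_measurable fK)).
under eq_fun do rewrite fpe_rhsE.
by apply: measurable_funD => //; apply: measurable_funD => //; exact: measurable_funM.
Qed.

Lemma summable_test_rhs (V : T1 -> R) (u b : R) : measurable_fun setT V ->
  summable_rv P1 (fun t1 => f (fpe_rhs u (V t1) b)).
Proof.
move=> mV; apply: (@summable_bounded _ _ _ _ _ 1); first exact: measurable_test_rhs.
by move=> t; exact: test_norm hf.
Qed.

Definition inner (V : T1 -> R) (b u : R) := \int[P1]_t1 f (fpe_rhs u (V t1) b).

Lemma inner_lipschitz (V : T1 -> R) b : measurable_fun setT V -> forall u u',
  `|inner V b u - inner V b u'| <= (K * `|1 - b|) * `|u - u'|.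
Proof.
move=> mV u u'; rewrite /inner -expectB; try exact: summable_test_rhs.
rewrite -[leRHS](expect_cst P1); apply: norm_expect_le.
- by apply: summableB; exact: summable_test_rhs.
- exact: summable_cst.
move=> t; apply: (le_trans (fK _ _)); rewrite -mulrA ler_wpM2l//.
rewrite !fpe_rhsE (_ : _ - _ = (1 - b) * (u - u')); last by ring.
by rewrite normrM.
Qed.

Lemma inner01 (V : T1 -> R) b u : measurable_fun setT V -> 0 <= inner V b u <= 1.
Proof.
move=> mV; apply/andP; split.
  by apply: Rintegral_ge0 => t _; case: hf => _ [/(_ (fpe_rhs u (V t) b))/andP[]].
rewrite -[leRHS](expect_cst P1); apply: le_expect.
- exact: summable_test_rhs.
- exact: summable_cst.
- by move=> t; case: hf => _ [/(_ (fpe_rhs u (V t) b))/andP[]].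
Qed.

Lemma measurable_inner (V : T1 -> R) b (U : T -> R) : measurable_fun setT V ->
  measurable_fun setT U -> measurable_fun setT (fun t => inner V b (U t)).
Proof.
move=> mV mU; apply: (measurableT_comp _ mU).
exact: lipschitz_measurable (inner_lipschitz b mV).
Qed.

Lemma summable_inner (V : T1 -> R) b (U : T -> R) : measurable_fun setT V ->
  measurable_fun setT U -> summable_rv P (fun t => inner V b (U t)).
Proof.
move=> mV mU; apply: (@summable_bounded _ _ _ _ _ 1); first exact: measurable_inner.
by move=> t; have /andP[i0 i1] := inner01 b (U t) mV; rewrite ger0_norm.
Qed.

(** Mean of the tested right-hand side for independent [U] and [V]; the iterated integral lets them
    live on different spaces. *)
Definition dbl (U : T -> R) (V : T1 -> R) (b : R) := \int[P]_t inner V b (U t).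

Lemma dbl01 U V b : measurable_fun setT U -> measurable_fun setT V ->
  0 <= dbl U V b <= 1.
Proof.
move=> mU mV; apply/andP; split.
  by apply: Rintegral_ge0 => t _; have /andP[] := inner01 b (U t) mV.
rewrite -[leRHS](expect_cst P); apply: le_expect.
- exact: summable_inner.
- exact: summable_cst.
- by move=> t; have /andP[] := inner01 b (U t) mV.
Qed.

Lemma dbl_dist U U' V V' b b' (al : T -> R) (be : T1 -> R) :
  measurable_fun setT U -> measurable_fun setT U' ->
  measurable_fun setT V -> measurable_fun setT V' ->
  summable_rv P al -> summable_rv P1 be ->
  (forall t t1, `|fpe_rhs (U t) (V t1) b - fpe_rhs (U' t) (V' t1) b'| <=
    al t + be t1) ->
  `|dbl U V b - dbl U' V' b'| <= K * (\int[P]_t al t + \int[P1]_t be t).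
Proof.
move=> mU mU' mV mV' ial ibe le.
rewrite /dbl -expectB; try exact: summable_inner.
have i1 : summable_rv P (fun t => al t + \int[P1]_t1 be t1).
  by apply: summableD => //; exact: summable_cst.
apply: (@le_trans _ _ (\int[P]_t (K * (al t + \int[P1]_t1 be t1)))).
  apply: norm_expect_le.
  - by apply: summableB; exact: summable_inner.
  - exact: summableZ.
  move=> t; rewrite /inner -expectB; try exact: summable_test_rhs.
  have i2 : summable_rv P1 (fun t1 => al t + be t1).
    by apply: summableD => //; exact: summable_cst.
  apply: (@le_trans _ _ (\int[P1]_t1 (K * (al t + be t1)))).
    apply: norm_expect_le.
    - by apply: summableB; exact: summable_test_rhs.
    - exact: summableZ.
    by move=> t1; apply: (le_trans (fK _ _)); rewrite ler_wpM2l.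
  rewrite expectZ// expectD//; last exact: summable_cst.
  by rewrite expect_cst.
rewrite expectZ// expectD//; last exact: summable_cst.
by rewrite expect_cst.
Qed.

End DoubleExpectation.

(** * Passing to the limit in the first child decomposition *)

Section LimitLaw.
Context d d1 dq {T : measurableType d} {T1 : measurableType d1}
  {S : measurableType dq} {R : realType}.
Context (P : probability T R) (P1 : probability T1 R) (Q : probability S R).
Context (th : R) (th0 : 0 < th) (parent : nat -> T -> nat)
  (parent1 : nat -> T1 -> nat)
  (hP : hoppe_process P th parent) (rP : forall t, recursive (parent ^~ t))
  (hP1 : hoppe_process P1 1 parent1) (rP1 : forall t, recursive (parent1 ^~ t)).
Context (X : T -> R) (X1 : T1 -> R)
  (mX : measurable_fun setT X) (mX1 : measurable_fun setT X1)
  (cX : {ae P, forall t, norm_ipl parent n t @[n --> \oo] --> X t})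
  (cX1 : {ae P1, forall t, norm_ipl parent1 n t @[n --> \oo] --> X1 t}).
Context (B : S -> R) (mB : measurable_fun setT B)
  (B01 : forall t, 0 < B t < 1) (lB : beta1_distributed Q th B).
Context (K : R) (f : R -> R) (hf : test_fun K f).

Let p1 : (0 : R) < 1. Proof. exact: ltr01. Qed.
Let fK : forall x y, `|f x - f y| <= K * `|x - y|. Proof. by case: hf => _ []. Qed.
Let K0 : 0 <= K. Proof. by case: hf. Qed.

Let Y m := norm_ipl parent m.+1 : T -> R.
Let Y1 m := norm_ipl parent1 m.+1 : T1 -> R.
Let mY m : measurable_fun setT (Y m). Proof. exact: measurable_norm_ipl th0 hP rP m. Qed.
Let mY1 m : measurable_fun setT (Y1 m). Proof. exact: measurable_norm_ipl p1 hP1 rP1 m. Qed.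

(** The [m.+2] nodes are the root, its first child and [m] draws. Given [k], the two parts are
    independent, so the subtree can be taken from the separate process [parent1]. *)
Lemma expect_test_norm_ipl m : \int[P]_t f (norm_ipl parent m.+2 t) =
  urn th m 0 0 (fun k => dbl P P1 f (Y (m - k)) (Y1 k) (k.+1%:R / m.+2%:R)).
Proof.
pose phi i := f ((i%:R - m.+2%:R * ln (m.+2%:R : R)) / m.+2%:R).
transitivity (\int[P]_t (fun s => phi (sumn s)) (depths (parent ^~ t) m.+1)).
  by apply: eq_Rintegral => t _; rewrite /norm_ipl ipl_depths.
rewrite (expect_depths hP rP m.+1 (fun s => phi (sumn s))) ipl_first_child//.
apply: eq_urn => k km.
rewrite -(expect_depths hP rP (m - k) (fun a => iter k (grow 1)
  (fun b => phi (sumn a + sumn b + k.+1)%N) [::])).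
apply: eq_Rintegral => t _.
rewrite -(expect_depths hP1 rP1 k (fun b =>
  phi (sumn (depths (parent ^~ t) (m - k)) + sumn b + k.+1)%N)).
apply: eq_Rintegral => t1 _; congr f.
have e : (m - k + k).+2 = m.+2 by rewrite subnK.
have := fpe_rhs_norm_ipl (R := R) parent parent1 (m - k) k t t1.
by rewrite e !ipl_depths => h; exact/esym.
Qed.

Let err j := \int[P]_t `|Y j t - X t|.
Let err1 j := \int[P1]_t `|Y1 j t - X1 t|.

Let iX := summable_ipl_limit th0 hP rP mX cX.
Let iX1 := summable_ipl_limit p1 hP1 rP1 mX1 cX1.

Let dbl_err m k : (k <= m)%N ->
  `|dbl P P1 f (Y (m - k)) (Y1 k) (k.+1%:R / m.+2%:R) -
    dbl P P1 f X X1 (k.+1%:R / m.+2%:R)| <=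
  K * ((m - k).+1%:R / m.+2%:R * err (m - k) + k.+1%:R / m.+2%:R * err1 k).
Proof.
move=> km; have i := summable_norm (summable_ipl_error th0 hP rP mX cX (m - k)).
have i1 := summable_norm (summable_ipl_error p1 hP1 rP1 mX1 cX1 k).
rewrite /err /err1 -(expectZ _ i) -(expectZ _ i1).
apply: (dbl_dist hf) => //; [exact: summableZ|exact: summableZ|].
move=> t t1; set x := k.+1%:R / m.+2%:R.
have -> : (m - k).+1%:R / m.+2%:R = 1 - x.
  have e : m.+2%:R = (m - k).+1%:R + k.+1%:R :> R by rewrite -natrD addSn addnS subnK.
  have n0 : m.+2%:R != 0 :> R by rewrite pnatr_eq0.
  by rewrite /x -[X in X - _](divff n0) -mulrBl e addrK.
have x0 : 0 <= x by rewrite divr_ge0.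
have x1 : 0 <= 1 - x by rewrite subr_ge0 ler_pdivrMr// mul1r ler_nat ltnW.
move: x x0 x1 => x x0 x1.
rewrite !fpe_rhsE (_ : _ - _ = (1 - x) * (Y (m - k) t - X t) + x * (Y1 k t1 - X1 t1));
  last by ring.
by apply: (le_trans (ler_normD _ _)); rewrite !normrM (ger0_norm x0) (ger0_norm x1).
Qed.

Let H := dbl P P1 f X X1.

Lemma continuous_dbl b : 0 < b < 1 -> {for b, continuous H}.
Proof.
move=> b01; set E := \int[P]_t `|X t|; set E1 := \int[P1]_t `|X1 t|.
have le b' : `|H b - H b'| <= K * (`|b - b'| * E + (`|b - b'| * E1 + `|toll b - toll b'|)).
  have i := summable_norm iX; have i1 := summable_norm iX1.
  have ic := summable_cst P1 `|toll b - toll b'|.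
  have i2 := summableZ `|b - b'| i1.
  rewrite /E /E1 -(expectZ _ i) -(expectZ _ i1) -[X in _ + (_ + X)](expect_cst P1) -expectD//.
  apply: (dbl_dist hf) => //; [exact: summableZ|exact: summableD|].
  move=> t t1; rewrite !fpe_rhsE (_ : _ - _ = - ((b - b') * X t) +
    ((b - b') * X1 t1 + (toll b - toll b'))); last by ring.
  apply: (le_trans (ler_normD _ _)); rewrite normrN normrM lerD2l.
  by apply: (le_trans (ler_normD _ _)); rewrite normrM.
suff h : (fun b' => K * (`|b - b'| * E + (`|b - b'| * E1 + `|toll b - toll b'|))) @ b
    --> (0 : R).
  apply/cvgrPdist_le => e e0.
  have : \forall b' \near b,
      K * (`|b - b'| * E + (`|b - b'| * E1 + `|toll b - toll b'|)) <= e.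
    exact: (cvgr_le (0 : R) h).
  by apply: filterS => b' /(le_trans (le b')).
have -> : (0 : R) = K * (`|b - b| * E + (`|b - b| * E1 + `|toll b - toll b|)).
  by rewrite !subrr normr0 !mul0r !addr0 mulr0.
have cb : (fun b' => `|b - b'|) @ b --> `|b - b|.
  by apply: cvg_norm; apply: cvgB => //; exact: cvg_cst.
have ct : (fun b' => `|toll b - toll b'|) @ b --> `|toll b - toll b|.
  by apply: cvg_norm; apply: cvgB; [exact: cvg_cst|exact: continuous_toll].
apply: cvgM; first exact: cvg_cst.
by apply: cvgD; [|apply: cvgD => //]; apply: cvgM => //; exact: cvg_cst.
Qed.

Let H_bound b : `|H b| <= 1.
Proof. by have /andP[h0 h1] := dbl01 P P1 hf b mX mX1; rewrite ger0_norm. Qed.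

Let bern_H_cvg s : (fun m => bern m (B s) (fun k => H (k.+1%:R / m.+2%:R)))
  @ \oo --> H (B s).
Proof. by apply: bern_cvg => //; exact: continuous_dbl. Qed.

Let mbern m (phi : nat -> R) : measurable_fun setT (fun s => bern m (B s) phi).
Proof. exact: (measurableT_comp (measurable_bern m phi) mB). Qed.

(** Continuity of [H] is established on the open unit interval only; measurability along [B] comes
    from the Bernstein polynomials. *)
Lemma measurable_dbl_B : measurable_fun setT (fun s => H (B s)).
Proof.
apply: (measurable_fun_cvg (h := fun m s =>
  bern m (B s) (fun k => H (k.+1%:R / m.+2%:R)))).
- by move=> m; exact: mbern.
- by move=> s _; exact: bern_H_cvg.
Qed.

Let b01 s : 0 <= B s <= 1. Proof. by have /andP[b0 b1] := B01 s; rewrite !ltW. Qed.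

(** In the finite decomposition both parts are replaced by their limits, uniformly in [k] by
    [dbl_err] and [weighted_cvg0]; what remains is a Bernstein polynomial of [H] at [B]. *)
Lemma expect_test_limit : \int[P]_t f (X t) = \int[Q]_s H (B s).
Proof.
have mf := lipschitz_measurable fK.
have lhs : (fun m => \int[P]_t f (norm_ipl parent m.+2 t)) @ \oo --> \int[P]_t f (X t).
  apply: (@expect_cvg_bounded _ _ _ _ _ _ 1).
  - by move=> m; apply: (measurableT_comp mf); exact: (mY m.+1).
  - exact: (measurableT_comp mf).
  - by move=> m t; exact: test_norm hf.
  - apply: filterS cX => t ct; apply: continuous_cvg.
      exact: (lipschitz_continuous fK).
    by rewrite -cvg_shiftS -cvg_shiftS in ct.
have rhs : (fun m => \int[Q]_s bern m (B s) (fun k => H (k.+1%:R / m.+2%:R)))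
    @ \oo --> \int[Q]_s H (B s).
  apply: (@expect_cvg_bounded _ _ _ _ _ _ 1).
  - by move=> m; exact: mbern.
  - exact: measurable_dbl_B.
  - by move=> m s; apply: bern_bounded.
  - by apply: aeW => s; exact: bern_H_cvg.
have dif : (fun m => \int[P]_t f (norm_ipl parent m.+2 t) -
    \int[Q]_s bern m (B s) (fun k => H (k.+1%:R / m.+2%:R))) @ \oo --> (0 : R).
  apply/cvgrPdist_le => e e0.
  (* Two errors of this size, times [K], stay below [e]; [1 + K] keeps the quotient meaningful when
     [K = 0]. *)
  have e20 : 0 < e / (2 * (1 + K)).
    by apply: divr_gt0 => //; apply: mulr_gt0 => //; rewrite ltr_pwDl.
  have c1 := expect_ipl_error_cvg0 th0 hP rP mX cX.
  have c2 := expect_ipl_error_cvg0 p1 hP1 rP1 mX1 cX1.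
  have w1 := weighted_cvg0 (fun j => Rintegral_ge0 _ (fun t _ => normr_ge0 _)) c1 e20.
  have w2 := weighted_cvg0 (fun j => Rintegral_ge0 _ (fun t _ => normr_ge0 _)) c2 e20.
  apply: filterS2 w1 w2 => m h1 h2.
  rewrite sub0r normrN expect_test_norm_ipl (urn_bern th0 mB B01 lB).
  have ib phi : summable_rv Q (fun s => bern m (B s) phi).
    have := summable_bern_poly Q mB B01 m 0 0 phi; congr (summable_rv Q _).
    by apply/funext => s; rewrite !expr0 !mul1r.
  rewrite -expectB// -[leRHS](expect_cst Q); apply: norm_expect_le.
  - exact: summableB.
  - exact: summable_cst.
  move=> s; rewrite -[X in X - _]mul1r -[X in _ - X]mul1r -mulNr -bern_linear.
  apply: bern_bounded => // k km; rewrite mul1r mulN1r.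
  apply: (le_trans (dbl_err km)).
  apply: (@le_trans _ _ (K * (e / (2 * (1 + K)) + e / (2 * (1 + K))))).
    by rewrite ler_wpM2l// lerD// ?h1 ?h2// leq_subr.
  have k1 : 0 < 1 + K by rewrite ltr_pwDl.
  rewrite (_ : K * _ = e * (K / (1 + K))); last by field; rewrite gt_eqF.
  rewrite -[leRHS]mulr1 ler_wpM2l ?(ltW e0)// ler_pdivrMr// mul1r.
  by rewrite lerDr.
have c : (fun m => \int[P]_t f (norm_ipl parent m.+2 t) -
    \int[Q]_s bern m (B s) (fun k => H (k.+1%:R / m.+2%:R))) @ \oo -->
    (\int[P]_t f (X t) - \int[Q]_s H (B s)) by exact: cvgB.
have := cvg_lim (@Rhausdorff R) c; rewrite (cvg_lim (@Rhausdorff R) dif).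
by move=> /(_ _)/esym/eqP; rewrite subr_eq0 => /eqP.
Qed.

End LimitLaw.

(** * Laws, independence and exchange of integrals *)

Section Laws.
Context {R : realType}.

Definition rv_of d d' (T : measurableType d) (E : measurableType d')
  (Q : probability T R) (Y : T -> E) (mY : measurable_fun setT Y) :
  {RV Q >-> E} := HB.pack Y (isMeasurableFun.Build _ _ T E Y mY).

Lemma eq_law_expect d d' dE (T : measurableType d) (T' : measurableType d')
    (E : measurableType dE) (Q : probability T R) (Q' : probability T' R)
    (Y : T -> E) (Y' : T' -> E) (g : E -> R) :
  measurable_fun setT Y -> measurable_fun setT Y' -> measurable_fun setT g ->
  (forall x, 0 <= g x) ->
  (forall A, measurable A -> Q (Y @^-1` A) = Q' (Y' @^-1` A)) ->
  \int[Q]_t g (Y t) = \int[Q']_t g (Y' t).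
Proof.
move=> mY mY' mg g0 e; rewrite /Rintegral; congr fine.
have mg' : measurable_fun setT (EFin \o g) by exact/measurable_EFinP.
have h := @ge0_integral_distribution _ _ _ _ _ Q (rv_of Q mY) (EFin \o g) mg'.
have h' := @ge0_integral_distribution _ _ _ _ _ Q' (rv_of Q' mY') (EFin \o g) mg'.
rewrite -[LHS]h; last by move=> x; rewrite lee_fin.
rewrite -[RHS]h'; last by move=> x; rewrite lee_fin.
by apply: eq_measure_integral => A mA _; exact: e.
Qed.

Lemma expect_indep d d1 d2 (T : measurableType d) (E1 : measurableType d1)
    (E2 : measurableType d2) (Q : probability T R) (Y1 : T -> E1) (Y2 : T -> E2)
    (g : E1 * E2 -> R) :
  measurable_fun setT Y1 -> measurable_fun setT Y2 -> measurable_fun setT g ->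
  (forall z, 0 <= g z <= 1) ->
  (forall A C, measurable A -> measurable C ->
    Q (Y1 @^-1` A `&` Y2 @^-1` C) = (Q (Y1 @^-1` A) * Q (Y2 @^-1` C))%E) ->
  \int[Q]_t g (Y1 t, Y2 t) = \int[Q]_t2 \int[Q]_t1 g (Y1 t1, Y2 t2).
Proof.
move=> m1 m2 mg g01 ind.
have mg' : measurable_fun setT (EFin \o g) by exact/measurable_EFinP.
have g0 z : (0 <= (EFin \o g) z)%E by rewrite lee_fin; have /andP[] := g01 z.
have m12 : measurable_fun setT (fun t => (Y1 t, Y2 t)) by exact: measurable_fun_pair.
pose D1 := distribution Q (rv_of Q m1); pose D2 := distribution Q (rv_of Q m2).
pose D12 := distribution Q (rv_of Q m12).
have e12 : (\int[Q]_t (g (Y1 t, Y2 t))%:E = \int[D1 \x D2]_z (g z)%:E)%E.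
  rewrite -[LHS](@ge0_integral_distribution _ _ _ _ _ Q (rv_of Q m12) (EFin \o g))//.
  apply/esym; apply: eq_measure_integral => A mA _.
  by apply: (product_measure_unique _ (m' := D12)) => // C1 C2 mC1 mC2; exact: ind.
rewrite /Rintegral e12 (@fubini_tonelli2 _ _ _ _ _ _ _ (EFin \o g))//; congr fine.
have mG := @measurable_fun_fubini_tonelli_G _ _ _ _ _ D1 (EFin \o g) mg' g0.
rewrite (@ge0_integral_distribution _ _ _ _ _ Q (rv_of Q m2) _ mG); last first.
  by move=> y; apply: integral_ge0.
apply: eq_integral => t2 _ /=; rewrite /fubini_G.
have mg2 : measurable_fun setT (fun x => (EFin \o g) (x, Y2 t2)).
  by apply: measurableT_comp => //; exact: measurable_pair2.
rewrite (@ge0_integral_distribution _ _ _ _ _ Q (rv_of Q m1) _ mg2)//.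
rewrite -expectE//; apply: (@summable_bounded _ _ _ _ _ 1).
  by apply/measurable_EFinP; exact: (measurableT_comp mg2 m1).
by move=> t; have /andP[g0' g1] := g01 (Y1 t, Y2 t2); rewrite ger0_norm.
Qed.

Lemma expect_swap d1 d2 (T1 : measurableType d1) (T2 : measurableType d2)
    (P1 : probability T1 R) (P2 : probability T2 R) (g : T1 * T2 -> R) :
  measurable_fun setT g -> (forall z, 0 <= g z <= 1) ->
  \int[P1]_x \int[P2]_y g (x, y) = \int[P2]_y \int[P1]_x g (x, y).
Proof.
move=> mg g01.
have mg' : measurable_fun setT (EFin \o g) by exact/measurable_EFinP.
have g0 z : (0 <= (EFin \o g) z)%E by rewrite lee_fin; have /andP[] := g01 z.
have i2 x : summable_rv P2 (fun y => g (x, y)).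
  apply: (@summable_bounded _ _ _ _ _ 1).
    by apply: (measurableT_comp mg); exact: measurable_pair1.
  by move=> y; have /andP[h0 h1] := g01 (x, y); rewrite ger0_norm.
have i1 y : summable_rv P1 (fun x => g (x, y)).
  apply: (@summable_bounded _ _ _ _ _ 1).
    by apply: (measurableT_comp mg); exact: measurable_pair2.
  by move=> x; have /andP[h0 h1] := g01 (x, y); rewrite ger0_norm.
have := @fubini_tonelli _ _ _ _ _ P1 P2 (EFin \o g) mg' g0.
under eq_integral do rewrite /= expectE//.
under [in RHS]eq_integral do rewrite /= expectE//.
by rewrite /Rintegral => ->.
Qed.

Lemma measurable_expect d1 d2 (T1 : measurableType d1) (T2 : measurableType d2)
    (P2 : probability T2 R) (g : T1 * T2 -> R) :
  measurable_fun setT g -> (forall z, 0 <= g z) ->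
  measurable_fun setT (fun x => \int[P2]_y g (x, y)).
Proof.
move=> mg g0; apply: (measurableT_comp (fine_measurable measurableT)).
apply: (@measurable_fun_fubini_tonelli_F _ _ _ _ _ P2 (EFin \o g)).
  exact/measurable_EFinP.
by move=> z; rewrite lee_fin.
Qed.

(** For fixed [C] both sides are finite measures in [D] that agree on rectangles. The order [(Y, X)]
    fits [dbl], which integrates over [Xt] innermost. *)
Lemma indep3_pair d (T : measurableType d) (Q : probability T R)
    (X Y Z : T -> R) :
  measurable_fun setT X -> measurable_fun setT Y -> measurable_fun setT Z ->
  indep3 Q X Y Z -> forall (D : set (R * R)) (C : set R),
  measurable D -> measurable C ->
  Q ((fun t => (Y t, X t)) @^-1` D `&` Z @^-1` C) =
  (Q ((fun t => (Y t, X t)) @^-1` D) * Q (Z @^-1` C))%E.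
Proof.
move=> mX mY mZ ind D C mD mC.
have mYX : measurable_fun setT (fun t => (Y t, X t)) by exact: measurable_fun_pair.
have mZC : measurable (Z @^-1` C) by rewrite -[X in measurable X]setTI; exact: mZ.
have q0 : 0 <= fine (Q (Z @^-1` C)) by exact: fine_ge0.
pose q : {nonneg R} := NngNum q0.
pose m0 : {measure set (R * R) -> \bar R} :=
  pushforward (mrestr Q mZC) (rv_of Q mYX).
pose m1 := m0 mYX.
pose m2 : {measure set (R * R) -> \bar R} :=
  mscale q (distribution Q (rv_of Q mYX)).
have qE : (fine (Q (Z @^-1` C)))%:E = Q (Z @^-1` C).
  by rewrite fineK// fin_num_measure.
suff : m1 D = m2 D by rewrite /m1 /m0 /m2 /= /mscale/= qE muleC.
apply: (measure_unique [set A `*` B | A in measurable & B in measurable] (fun=> setT)) => //.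
- exact: measurable_prod_measurableType.
- move=> _ _ [A mA [B mB <-]] [A' mA' [B' mB' <-]]; rewrite -setXI.
  by exists (A `&` A'); [exact: measurableI|exists (B `&` B') => //; exact: measurableI].
- by move=> _; exists setT => //; exists setT => //; rewrite setXTT.
- by rewrite bigcup_const//; exists 0%N.
- move=> _ [A mA [B mB <-]]; rewrite /m1 /m0 /m2 /= /mscale/= qE.
  rewrite /mrestr /distribution/=.
  have e : (fun t => (Y t, X t)) @^-1` (A `*` B) = X @^-1` B `&` Y @^-1` A.
    by apply/seteqP; split => t /= [].
  have := ind B A setT mB mA measurableT.
  rewrite preimage_setT setIT probability_setT mule1 => h.
  by rewrite /pushforward e h (ind B A C mB mA mC) muleC.
- move=> _; apply: (le_lt_trans (y := 1%E)); last exact: ltry.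
  exact: (probability_le1 Q (measurableI _ _ measurableT mZC)).
Qed.

End Laws.

(** * Test functions determine the law *)

Section TestLaws.
Context {R : realType}.

(* Piecewise linear approximation from below of the indicator of ]-oo, a[. *)
Definition ramp (a : R) (k : nat) (x : R) : R :=
  Num.max 0 (Num.min 1 (k%:R * (a - x))).

Lemma ramp_test a k : test_fun k%:R (ramp a k).
Proof.
split; first by []; split=> [x|x y]; rewrite /ramp.
  by rewrite le_max lexx/= ge_max ler01 ge_min lexx.
have lipmax (u v : R) : `|Num.max 0 u - Num.max 0 v| <= `|u - v|.
  have := ler_norm (u - v); have := ler_norm (v - u); rewrite distrC.
  move: `|u - v| => w h1 h2; rewrite ler_norml; apply/andP.
  by case: (leP 0 u) => u0; case: (leP 0 v) => v0; split; lra.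
have lipmin (u v : R) : `|Num.min 1 u - Num.min 1 v| <= `|u - v|.
  have := ler_norm (u - v); have := ler_norm (v - u); rewrite distrC.
  move: `|u - v| => w h1 h2; rewrite ler_norml; apply/andP.
  by case: (leP 1 u) => u0; case: (leP 1 v) => v0; split; lra.
apply: (le_trans (lipmax _ _)); apply: (le_trans (lipmin _ _)).
rewrite (_ : _ - _ = k%:R * (y - x)); last by ring.
by rewrite normrM ger0_norm// distrC.
Qed.

Lemma ramp_cvg (a x : R) : ramp a ^~ x @ \oo --> (\1_(`]-oo, a[%classic) x : R).
Proof.
rewrite indicE; have [xa|ax] := ltP x a.
  rewrite mem_set ?in_itv//=; apply: cvg_near_cst.
  have ax : 0 < a - x by rewrite subr_gt0.
  near=> k; rewrite /ramp min_l ?max_r//.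
  rewrite -ler_pdivrMr// mul1r; near: k; exact: nbhs_infty_ger.
rewrite memNset/=; last by rewrite in_itv/=; apply/negP; rewrite -leNgt.
apply: cvg_near_cst; apply: nearW => k; rewrite /ramp.
apply/max_idPl; rewrite ge_min; apply/orP; right.
by rewrite mulr_ge0_le0// subr_le0.
Unshelve. all: by end_near. Qed.

(** Ramps yield the probabilities of open left rays, a class closed under intersection that
    generates the Borel sets. *)
Lemma eq_law_test d d' (T : measurableType d) (T' : measurableType d')
    (Q : probability T R) (Q' : probability T' R) (X : T -> R) (X' : T' -> R) :
  measurable_fun setT X -> measurable_fun setT X' ->
  (forall K f, test_fun K f -> \int[Q]_t f (X t) = \int[Q']_t f (X' t)) ->
  forall A, measurable A -> Q (X @^-1` A) = Q' (X' @^-1` A).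
Proof.
move=> mX mX' e A mA.
have lim d0 (T0 : measurableType d0) (P : probability T0 R) (Z : T0 -> R) a :
    measurable_fun setT Z -> (fun k => \int[P]_t ramp a k (Z t)) @ \oo -->
      \int[P]_t (\1_(`]-oo, a[%classic) (Z t) : R).
  move=> mZ; apply: (@expect_cvg_bounded _ _ _ _ _ _ 1).
  - move=> k; apply: (measurableT_comp _ mZ); have [_ [_ h]] := ramp_test a k.
    exact: lipschitz_measurable h.
  - by apply: (measurableT_comp _ mZ); exact: measurable_indic.
  - by move=> k t; exact: test_norm (ramp_test a k).
  - by apply: aeW => t; exact: ramp_cvg.
have mpre d0 (T0 : measurableType d0) (Z : T0 -> R) C : measurable_fun setT Z ->
    measurable C -> measurable (Z @^-1` C).
  by move=> mZ mC; rewrite -[X in measurable X]setTI; exact: mZ.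
have ray a : Q (X @^-1` `]-oo, a[%classic) = Q' (X' @^-1` `]-oo, a[%classic).
  have mr : measurable (`]-oo, a[%classic : set R) by exact: measurable_itv.
  rewrite -[LHS]fineK ?fin_num_measure//; last exact: mpre.
  rewrite -[RHS]fineK ?fin_num_measure//; last exact: mpre.
  congr _%:E; rewrite -!expect_indic; try exact: mpre.
  have c1 := lim _ _ Q X a mX; have c2 := lim _ _ Q' X' a mX'.
  have c12 : (fun k => \int[Q]_t ramp a k (X t)) = (fun k => \int[Q']_t ramp a k (X' t)).
    by apply/funext => k; exact: e (ramp_test a k).
  rewrite c12 in c1; exact: cvg_unique c1 c2.
have h := @measure_unique _ _ (measurableTypeR R) (@RGenInftyO.G R)
  (fun k => `]-oo, k%:R[%classic).
apply: (h R _ _ _ _ (distribution Q (@rv_of R _ _ _ (measurableTypeR R) Q X mX))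
  (distribution Q' (@rv_of R _ _ _ (measurableTypeR R) Q' X' mX'))) => //.
- exact: RGenInftyO.measurableE.
- move=> _ _ [x ->] [y ->]; exists (Num.min x y).
  by apply/seteqP; split => z /=; rewrite !in_itv/= lt_min => /andP.
- by move=> k; exists k%:R.
- apply/seteqP; split => // x _; exists (Num.truncn x).+1 => //=.
  by rewrite in_itv/= truncnS_gt.
- by move=> _ [x ->]; exact: ray.
- move=> k; apply: (le_lt_trans (y := 1%E)); last exact: ltry.
  exact: (probability_le1 Q (mpre _ _ X _ mX (measurable_itv _))).
Qed.

End TestLaws.

(** * The fixed point operator and its contraction *)

Section FixedPoint.
Context {R : realType}.

Lemma measurable_rhs3 d (E : measurableType d) (u v b : E -> R) :
  measurable_fun setT u -> measurable_fun setT v -> measurable_fun setT b ->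
  measurable_fun setT (fun z => fpe_rhs (u z) (v z) (b z)).
Proof.
move=> mu mv mb; under eq_fun do rewrite fpe_rhsE.
apply: measurable_funD; last exact: (measurableT_comp measurable_toll mb).
apply: measurable_funD; apply: measurable_funM => //.
exact: measurable_funB.
Qed.

Section Triple.
Context d (S : measurableType d) (Q : probability S R) (th : R) (X' Xt B : S -> R).
Hypotheses (mX : measurable_fun setT X') (mXt : measurable_fun setT Xt)
  (mB : measurable_fun setT B) (B01 : forall t, 0 < B t < 1)
  (ind : indep3 Q X' Xt B).
Context (K : R) (f : R -> R) (hf : test_fun K f).

Let mf : measurable_fun setT f.
Proof. by have [_ [_ h]] := hf; exact: lipschitz_measurable h. Qed.
Let f01 x : 0 <= f x <= 1. Proof. by case: hf => _ []. Qed.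

Lemma expect_fpe_rhs :
  \int[Q]_s f (fpe_rhs (X' s) (Xt s) (B s)) = \int[Q]_s dbl Q Q f X' Xt (B s).
Proof.
have mp : measurable_fun setT (fun s => (Xt s, X' s)) by exact: measurable_fun_pair.
have h1 := @expect_indep R _ _ _ _ _ _ Q (fun s => (Xt s, X' s)) B
  (fun z => f (fpe_rhs z.1.2 z.1.1 z.2)) mp mB.
rewrite h1; last 3 first.
- apply: (measurableT_comp mf); apply: measurable_rhs3 => //.
    exact: measurableT_comp.
  exact: measurableT_comp.
- by move=> z; exact: f01.
- by move=> D C mD mC; exact: (indep3_pair mX mXt mB ind).
apply: eq_Rintegral => s _ /=; rewrite /dbl.
have h2 := @expect_indep R _ _ _ _ _ _ Q Xt X'
  (fun z => f (fpe_rhs z.2 z.1 (B s))) mXt mX.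
rewrite h2//.
- by apply: (measurableT_comp mf); exact: measurable_rhs3.
- move=> A C mA mC; have := ind mC mA (@measurableT _ _).
  by rewrite preimage_setT setIT probability_setT mule1 setIC => ->; rewrite muleC.
Qed.

(** Dual of the map on laws: under a solution, [f] and [fpe_op] of [f] have the same mean. *)
Definition fpe_op x : R := \int[Q]_s inner Q f Xt (B s) x.

Let minner2 d0 (T0 : measurableType d0) (U : T0 -> R) : measurable_fun setT U ->
  measurable_fun setT (fun z : S * T0 => inner Q f Xt (B z.1) (U z.2)).
Proof.
move=> mU; apply: (@measurable_expect R _ _ _ _ Q
  (fun w : (S * T0) * S => f (fpe_rhs (U w.1.2) (Xt w.2) (B w.1.1)))).
  apply: (measurableT_comp mf); apply: measurable_rhs3.
  - apply: (measurableT_comp mU); exact: measurableT_comp.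
  - exact: measurableT_comp.
  - apply: (measurableT_comp mB); exact: measurableT_comp.
by move=> z; have /andP[] := f01 (fpe_rhs (U z.1.2) (Xt z.2) (B z.1.1)).
Qed.

Lemma expect_dbl_op d0 (T0 : measurableType d0) (P : probability T0 R) (U : T0 -> R) :
  measurable_fun setT U ->
  \int[Q]_s dbl P Q f U Xt (B s) = \int[P]_t fpe_op (U t).
Proof.
move=> mU; rewrite /dbl /fpe_op.
have := @expect_swap R _ _ _ _ Q P
  (fun z : S * T0 => inner Q f Xt (B z.1) (U z.2)) (minner2 mU).
by apply => z; exact: (inner01 Q hf (B z.1) (U z.2) mXt).
Qed.

Let minner x : measurable_fun setT (fun s => inner Q f Xt (B s) x).
Proof.
exact: (measurableT_comp (minner2 (U := id) (@measurable_id _ _ _)) (measurable_pair2 x)).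
Qed.

Let sinner x : summable_rv Q (fun s => inner Q f Xt (B s) x).
Proof.
apply: (@summable_bounded _ _ _ _ _ 1) => // s.
by have /andP[h0 h1] := inner01 Q hf (B s) x mXt; rewrite ger0_norm.
Qed.

Lemma summable_onem : summable_rv Q (fun s => 1 - B s).
Proof.
apply: (@summable_bounded _ _ _ _ _ 1); first exact: measurable_funB.
move=> s; have /andP[b0 b1] := B01 s; rewrite ger0_norm ?subr_ge0 ?ltW//.
by rewrite ltrBlDr ltrDl.
Qed.

Lemma fpe_op_test : test_fun (K * \int[Q]_s (1 - B s)) fpe_op.
Proof.
have [K0 [_ fK]] := hf; have c0 : 0 <= \int[Q]_s (1 - B s).
  by apply: Rintegral_ge0 => s _; rewrite subr_ge0; have /andP[_ /ltW] := B01 s.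
split; first exact: mulr_ge0; split=> [x|x y].
  apply/andP; split.
    by apply: Rintegral_ge0 => s _; have /andP[] := inner01 Q hf (B s) x mXt.
  rewrite -[leRHS](expect_cst Q); apply: le_expect => //; first exact: summable_cst.
  by move=> s; have /andP[] := inner01 Q hf (B s) x mXt.
rewrite /fpe_op -expectB// mulrAC -expectZ; last exact: summable_onem.
apply: norm_expect_le.
- exact: summableB.
- exact/summableZ/summable_onem.
move=> s; apply: (le_trans (inner_lipschitz Q hf (B s) mXt x y)).
have /andP[_ b1] := B01 s.
have e : `|1 - B s| = 1 - B s by rewrite ger0_norm// subr_ge0 ltW.
by rewrite e mulrAC.
Qed.

End Triple.

Section Uniqueness.
Context d (S : measurableType d) (Q : probability S R) (Xt B : S -> R).
Hypotheses (mXt : measurable_fun setT Xt) (mB : measurable_fun setT B)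
  (B01 : forall t, 0 < B t < 1).

Definition fpe_iter n f := iter n (fpe_op Q Xt B) f.

Let c : R := \int[Q]_s (1 - B s).

Lemma contraction_lt1 : 0 <= c < 1.
Proof.
have i := summable_onem Q mB B01.
apply/andP; split.
  by apply: Rintegral_ge0 => s _; rewrite subr_ge0; have /andP[_ /ltW] := B01 s.
have iB : summable_rv Q B.
  apply: (@summable_bounded _ _ _ _ _ 1) => // s.
  by have /andP[b0 /ltW b1] := B01 s; rewrite ger0_norm// ltW.
rewrite /c expectB//; last exact: summable_cst.
rewrite expect_cst ltrBlDr ltrDl lt_def; apply/andP; split; last first.
  by apply: Rintegral_ge0 => s _; have /andP[/ltW] := B01 s.
apply/eqP => B0.
(* If [B] had mean 0, every [g n] would have mean 0, but [g n] tends to 1 pointwise because [B] is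
   positive. *)
pose g (n : nat) s := Num.min 1 (n%:R * B s) : R.
have mg n : measurable_fun setT (g n).
  by apply: measurable_minr => //; exact: measurable_funM.
have g1 n s : `|g n s| <= 1.
  have /andP[/ltW b0 _] := B01 s; rewrite ger0_norm /g ?ge_min ?lexx//.
  by rewrite le_min ler01 mulr_ge0.
have lim : (fun n => \int[Q]_s g n s) @ \oo --> \int[Q]_s (1 : R).
  apply: (@expect_cvg_bounded _ _ _ _ _ _ 1) => //.
  apply: aeW => s; have /andP[b0 _] := B01 s; apply: cvg_near_cst.
  near=> n; rewrite /g min_l// -ler_pdivrMr// div1r; near: n.
  exact: nbhs_infty_ger.
have g0 n : \int[Q]_s g n s = 0.
  apply/eqP; rewrite eq_le; apply/andP; split; last first.
    apply: Rintegral_ge0 => s _; have /andP[/ltW b0 _] := B01 s.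
    by rewrite le_min ler01 mulr_ge0.
  rewrite -[leRHS](mulr0 n%:R) -B0 -expectZ//; apply: le_expect.
  - by apply: (@summable_bounded _ _ _ _ _ 1).
  - exact: summableZ.
  - by move=> s; rewrite /g ge_min lexx orbT.
have lim0 : (fun n => \int[Q]_s g n s) @ \oo --> (0 : R).
  by apply: cvg_near_cst; apply: nearW => n; exact: g0.
rewrite expect_cst in lim; have h : (1 : R) = 0 by exact: cvg_unique lim lim0.
by move/eqP: h; rewrite oner_eq0.
Unshelve. all: by end_near. Qed.

Lemma fpe_iter_test K f n : test_fun K f -> test_fun (K * c ^+ n) (fpe_iter n f).
Proof.
move=> hf; elim: n => [|n IH]; first by rewrite mulr1.
by rewrite exprSr mulrA; exact: (fpe_op_test Q mXt mB B01 IH).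
Qed.

Lemma fpe_solution_expect d0 (T0 : measurableType d0) (P : probability T0 R)
    (U : T0 -> R) K f : measurable_fun setT U ->
  (forall K f, test_fun K f ->
    \int[P]_t f (U t) = \int[P]_t fpe_op Q Xt B f (U t)) ->
  test_fun K f -> (fun n => fpe_iter n f 0) @ \oo --> \int[P]_t f (U t).
Proof.
move=> mU fix_f hf.
have mi n : measurable_fun setT (fpe_iter n f).
  by have [_ [_ h]] := fpe_iter_test n hf; exact: lipschitz_measurable h.
have si n : summable_rv P (fun t => fpe_iter n f (U t)).
  apply: (@summable_bounded _ _ _ _ _ 1); first exact: measurableT_comp.
  by move=> t; exact: test_norm (fpe_iter_test n hf).
have e n : \int[P]_t f (U t) = \int[P]_t fpe_iter n f (U t).
  elim: n => [//|n IH]; rewrite IH.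
  exact: fix_f (fpe_iter_test n hf).
(* Pointwise the difference is at most [K * c ^+ n * |U t|], which tends to 0; the constant 2
   dominates. *)
have dif : (fun n => \int[P]_t (fpe_iter n f 0 - fpe_iter n f (U t))) @ \oo -->
    \int[P]_t (0 : R).
  apply: (@expect_cvg_bounded _ _ _ _ _ _ 2) => //.
  - by move=> n; apply: measurable_funB => //; exact: measurableT_comp.
  - move=> n t; apply: (le_trans (ler_normB _ _)).
    have h := fpe_iter_test n hf.
    by rewrite (lerD (test_norm _ h) (test_norm _ h)).
  apply: aeW => t; apply/cvgr0Pnorm_le => eps eps0.
  have /andP[c0 c1] := contraction_lt1.
  have cv : (fun n => K * c ^+ n * `|U t|) @ \oo --> (0 : R).
    have -> : (0 : R) = K * 0 * `|U t| by rewrite mulr0 mul0r.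
    apply: cvgM; last exact: cvg_cst.
    by apply: cvgM; [exact: cvg_cst|apply: cvg_expr; rewrite ger0_norm].
  have : \forall n \near \oo, K * c ^+ n * `|U t| <= eps by exact: (cvgr_le (0 : R)).
  apply: filterS => n; apply: le_trans.
  have [_ [_ h]] := fpe_iter_test n hf.
  by rewrite (le_trans (h _ _))// sub0r normrN.
rewrite expect_cst in dif.
have cc : (fun=> \int[P]_t f (U t)) @ \oo --> (\int[P]_t f (U t) : R).
  exact: cvg_cst.
have -> : (fun n => fpe_iter n f 0) = (fun n =>
    \int[P]_t (fpe_iter n f 0 - fpe_iter n f (U t)) + \int[P]_t f (U t)).
  apply/funext => n; rewrite expectB//; last exact: summable_cst.
  by rewrite expect_cst [X in _ = _ + X](e n) subrK.
have := cvgD dif cc; rewrite add0r; exact.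
Qed.

Lemma fpe_unique d0 d1 (T0 : measurableType d0) (T1 : measurableType d1)
    (P : probability T0 R) (P' : probability T1 R) (U : T0 -> R) (U' : T1 -> R) :
  measurable_fun setT U -> measurable_fun setT U' ->
  (forall K f, test_fun K f ->
    \int[P]_t f (U t) = \int[P]_t fpe_op Q Xt B f (U t)) ->
  (forall K f, test_fun K f ->
    \int[P']_t f (U' t) = \int[P']_t fpe_op Q Xt B f (U' t)) ->
  forall A, measurable A -> P (U @^-1` A) = P' (U' @^-1` A).
Proof.
move=> mU mU' h h'; apply: eq_law_test => // K f hf.
exact: cvg_unique (fpe_solution_expect mU h hf) (fpe_solution_expect mU' h' hf).
Qed.

End Uniqueness.

End FixedPoint.

(** * Versions of the beta variable inside the open unit interval *)

Section BetaOpen.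
Context {R : realType} d (S : measurableType d) (Q : probability S R).
Context (th : R) (B : S -> R).
Hypotheses (mB : measurable_fun setT B) (lB : beta1_distributed Q th B).

Lemma beta_open_ae : {ae Q, forall s, 0 < B s < 1}.
Proof.
pose N : set R := [set 0; 1].
have mN : measurable N by apply: measurableU; exact: measurable_set1.
have mpre C : measurable C -> measurable (B @^-1` C).
  by move=> mC; rewrite -[X in measurable X]setTI; exact: mB.
have mo : measurable (`]0, 1[%classic : set R) by exact: measurable_itv.
have mpo := mpre _ (measurableC mo).
exists (B @^-1` (~` `]0, 1[%classic)); split => //.
have -> : Q (B @^-1` (~` `]0, 1[%classic)) =
    (\int[@lebesgue_measure R]_(x in N) ((th * powR (1 - x) (th - 1))%:E))%E.
  rewrite (lB (measurableC mo)); congr (integral _ _ _).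
  apply/seteqP; split => x; rewrite /N /=.
    rewrite in_itv/= => -[/negP]; rewrite negb_and -!leNgt => /orP[] x0 /andP[x1 x2].
      by left; apply/eqP; rewrite eq_le x0.
    by right; apply/eqP; rewrite eq_le x0 x2.
  by rewrite in_itv/= => -[->|->]; rewrite ?lexx ?ltxx ?ler01 ?andbF.
apply: null_set_integral => //.
  apply/measurable_EFinP/(measurable_funS measurableT) => //.
  apply: measurable_funM => //.
  by apply: (measurableT_comp (measurable_powR _)); exact: measurable_funB.
by apply: countable_lebesgue_measure0; apply: finite_set_countable; exact: finite_set2.
Qed.

(** The law places [B] in the open interval only almost surely, while the preceding sections ask for
    it everywhere. On the exceptional null set [B] is set to 1/2. *)
Lemma beta_open_version (X Xt : S -> R) :
  measurable_fun setT X -> measurable_fun setT Xt -> indep3 Q X Xt B ->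
  exists B' : S -> R, [/\ measurable_fun setT B', forall s, 0 < B' s < 1,
    indep3 Q X Xt B', beta1_distributed Q th B' &
    forall A, measurable A ->
      Q ((fun s => fpe_rhs (X s) (Xt s) (B s)) @^-1` A) =
      Q ((fun s => fpe_rhs (X s) (Xt s) (B' s)) @^-1` A)].
Proof.
move=> mX mXt ind; pose B' s := if 0 < B s < 1 then B s else 2^-1.
have mB' : measurable_fun setT B'.
  apply: measurable_fun_ifT => //; apply: measurable_and.
    exact: measurable_fun_ltr.
  exact: measurable_fun_ltr.
have mpre (Z : S -> R) C : measurable_fun setT Z -> measurable C ->
    measurable (Z @^-1` C).
  by move=> mZ mC; rewrite -[X in measurable X]setTI; exact: mZ.
have e : {ae Q, forall s, B' s = B s}.
  by apply: filterS beta_open_ae => s h; rewrite /B' h.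
exists B'; split => //.
- move=> s; rewrite /B'; case: ifP => // _.
  by rewrite invr_gt0 ltr0n/= invf_lt1 ?ltr1n ?ltr0n.
- move=> A C D mA mC mD; have := ind A C D mA mC mD.
  have mAC := measurableI _ _ (mpre X A mX mA) (mpre Xt C mXt mC).
  have -> : Q (B' @^-1` D) = Q (B @^-1` D).
    apply: probability_ae; [exact: mpre|exact: mpre|].
    by apply: filterS e => s es; rewrite /preimage /= es.
  move=> <-; apply: probability_ae.
  + by apply: measurableI => //; exact: mpre.
  + by apply: measurableI => //; exact: mpre.
  by apply: filterS e => s es; rewrite /preimage /= es.
- move=> A mA; rewrite -(lB mA).
  apply: probability_ae; [exact: mpre|exact: mpre|].
  by apply: filterS e => s es; rewrite /preimage /= es.
- move=> A mA; apply: probability_ae.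
  + by apply: mpre => //; exact: measurable_rhs3.
  + by apply: mpre => //; exact: measurable_rhs3.
  by apply: filterS e => s es; rewrite /preimage /= es.
Qed.

End BetaOpen.

(** Serves to exchange the variables of a given solution for limits living on other probability
    spaces. *)
Lemma eq_law_dbl {R : realType} d d' d1 d1' (T : measurableType d)
    (T' : measurableType d') (T1 : measurableType d1) (T1' : measurableType d1')
    (P : probability T R) (P' : probability T' R) (P1 : probability T1 R)
    (P1' : probability T1' R) (K : R) (f : R -> R) (U : T -> R) (U' : T' -> R)
    (V : T1 -> R) (V' : T1' -> R) (b : R) :
  test_fun K f ->
  measurable_fun setT U -> measurable_fun setT U' ->
  measurable_fun setT V -> measurable_fun setT V' ->
  (forall A, measurable A -> P (U @^-1` A) = P' (U' @^-1` A)) ->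
  (forall A, measurable A -> P1 (V @^-1` A) = P1' (V' @^-1` A)) ->
  dbl P P1 f U V b = dbl P' P1' f U' V' b.
Proof.
move=> hf mU mU' mV mV' eU eV; have [_ [f01 fK]] := hf.
have ei : inner P1 f V b = inner P1' f V' b.
  apply/funext => u; apply: (@eq_law_expect _ _ _ _ _ _ R _ _ _ _
    (fun v => f (fpe_rhs u v b))) => //.
    exact: (measurable_test_rhs hf u b (@measurable_id _ _ setT)).
  by move=> v; have /andP[] := f01 (fpe_rhs u v b).
rewrite /dbl ei; apply: (@eq_law_expect _ _ _ _ _ _ R _ _ _ _
    (inner P1' f V' b)) => //.
  exact: lipschitz_measurable (inner_lipschitz P1' hf b mV').
by move=> u; have /andP[] := inner01 P1' hf b u mV'.
Qed.

(** * Existence and uniqueness for limits of recursive processes *)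

Section RecursiveProcess.
Context {R : realType} d d1 (T : measurableType d) (T1 : measurableType d1)
  (P : probability T R) (P1 : probability T1 R) (th : R) (th0 : 0 < th)
  (parent : nat -> T -> nat) (parent1 : nat -> T1 -> nat)
  (hP : hoppe_process P th parent) (rP : forall t, recursive (parent ^~ t))
  (hP1 : hoppe_process P1 1 parent1) (rP1 : forall t, recursive (parent1 ^~ t))
  (X : T -> R) (X1 : T1 -> R)
  (mX : measurable_fun setT X) (mX1 : measurable_fun setT X1)
  (cX : {ae P, forall t, norm_ipl parent n t @[n --> \oo] --> X t})
  (cX1 : {ae P1, forall t, norm_ipl parent1 n t @[n --> \oo] --> X1 t}).

Lemma ipl_limit_fpe_solution : fpe_solution th (law P1 X1) (law P X).
Proof.
move=> d' S Q X' Xt B mX' mXt mB ind lX' lXt lB.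
have [B' [mB' B01 ind' lB' eB]] := beta_open_version mB lB mX' mXt ind.
move=> A mA; rewrite [LHS]eB//; move: A mA.
apply: eq_law_test => //; first exact: measurable_rhs3.
move=> K f hf; rewrite (expect_fpe_rhs mX' mXt mB' ind' hf).
rewrite (expect_test_limit th0 hP rP hP1 rP1 mX mX1 cX cX1 mB' B01 lB' hf).
by apply: eq_Rintegral => s _; exact: (eq_law_dbl _ hf).
Qed.

(** The operator is built from the solution's own [Xt] and [B']. It preserves the mean under [X'] by
    the equation, and under the limit [X] by [expect_test_limit], since [Xt] and [X1] have the same
    law. *)
Lemma ipl_limit_fpe_unique (mu : set R -> \bar R) :
  fpe_solution_some th (law P1 X1) mu ->
  forall A, measurable A -> mu A = law P X A.
Proof.
move=> [d' [S [Q [X' [Xt [B [mX' [mXt [mB [ind [lX' [lXt [lB lrhs]]]]]]]]]]]]].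
have [B' [mB' B01 ind' lB' eB]] := beta_open_version mB lB mX' mXt ind.
move=> A mA; rewrite -(lX' A mA) /law; move: A mA.
apply: (fpe_unique (Q := Q) mXt mB' B01 mX' mX) => K f hf; have [_ [f01 fK]] := hf.
  rewrite -(expect_dbl_op Q mXt mB' hf Q mX') -(expect_fpe_rhs mX' mXt mB' ind' hf).
  apply: (@eq_law_expect _ _ _ _ _ _ R _ _ _
    (fun s => fpe_rhs (X' s) (Xt s) (B' s)) f mX') => //.
  - exact: measurable_rhs3.
  - exact: lipschitz_measurable fK.
  - by move=> x; have /andP[] := f01 x.
  - by move=> A mA; rewrite -(eB A mA) (lrhs A mA) (lX' A mA).
rewrite -(expect_dbl_op Q mXt mB' hf P mX).
rewrite (expect_test_limit th0 hP rP hP1 rP1 mX mX1 cX cX1 mB' B01 lB' hf).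
apply: eq_Rintegral => s _; apply: (eq_law_dbl _ hf) => // A mA.
by rewrite (lXt A mA).
Qed.

End RecursiveProcess.

(** * Transfer between a process and its clipped version *)

Section Clipping.
Context {R : realType} d (T : measurableType d) (P : probability T R).
Context (th : R) (th0 : 0 < th) (parent : nat -> T -> nat).
Hypothesis hP : hoppe_process P th parent.

Lemma norm_ipl_clip_ae :
  {ae P, forall t, forall n, norm_ipl (clip parent) n t = norm_ipl parent n t :> R}.
Proof.
apply: filterS (clip_ae th0 hP) => t e n; rewrite /norm_ipl; congr ((_%:R - _) / _).
rewrite /ipl; apply: eq_bigr => k _; apply: depth_local; first exact: recursive_clip.
by apply/agreeP => j /andP[j0 _]; exact: e.
Qed.

Lemma clip_limit (X : T -> R) :
  {ae P, forall t, norm_ipl parent n t @[n --> \oo] --> X t} <->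
  {ae P, forall t, norm_ipl (clip parent) n t @[n --> \oo] --> X t}.
Proof.
have e := norm_ipl_clip_ae; split; apply: filterS2 e => t et.
  by rewrite (_ : norm_ipl (clip parent) ^~ t = norm_ipl parent ^~ t)//; exact/funext.
by rewrite (_ : norm_ipl (clip parent) ^~ t = norm_ipl parent ^~ t)//; exact/funext.
Qed.

Lemma measurable_norm_ipl_any n :
  measurable_fun setT (norm_ipl parent n : T -> R).
Proof.
have mf fuel : forall j v,
    measurable [set t | depth_fuel (parent ^~ t) fuel j = v].
  elim: fuel => [|fuel IH] j v /=.
    by have [->|h] := eqVneq v 0%N; [rewrite (_ : mkset _ = setT)//; apply/seteqP|
      rewrite (_ : mkset _ = set0)//; apply/seteqP; split => // t /= /esym/eqP; rewrite (negbTE h)].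
  case: eqP => _.
    by have [->|h] := eqVneq v 0%N; [rewrite (_ : mkset _ = setT)//; apply/seteqP|
      rewrite (_ : mkset _ = set0)//; apply/seteqP; split => // t /= /esym/eqP; rewrite (negbTE h)].
  case: v => [|v]; first by rewrite (_ : mkset _ = set0)//; apply/seteqP; split.
  rewrite (_ : mkset _ = \bigcup_i (parent j @^-1` [set i] `&`
    [set t | depth_fuel (parent ^~ t) fuel i = v])).
    by apply: bigcupT_measurable => i; apply: measurableI => //; exact: hP.1.
  apply/seteqP; split => t /=; first by move=> [h]; exists (parent j t).
  by move=> [i _ [/= ->]] ->.
have md k : measurable_fun setT (fun t => (depth (parent ^~ t) k)%:R : R).
  move=> _ A mA; rewrite setTI.
  rewrite (_ : _ @^-1` _ = \bigcup_(v in [set v : nat | A v%:R])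
    [set t | depth (parent ^~ t) k = v]).
    by apply: bigcup_measurable => v _; exact: mf.
  apply/seteqP; split => t /=; first by move=> h; exists (depth (parent ^~ t) k).
  by move=> [v /= Av ->].
rewrite /norm_ipl; apply: measurable_funM => //; apply: measurable_funB => //.
under eq_fun do rewrite /ipl natr_sum.
by apply: measurable_sum => k; exact: md.
Qed.

End Clipping.

Theorem theorem2p7 (R : realType) (theta : R) (htheta : 0 < theta)
  (d : measure_display) (T : measurableType d) (P : probability T R)
  (parent : nat -> T -> nat) (hP : hoppe_process P theta parent) :
  exists X : T -> R,
    [/\ measurable_fun setT X,
        (* almost sure convergence *)
        {ae P, forall t, norm_ipl parent n t @[n --> \oo] --> X t},
        (* L2 convergence *)
        P.-integrable setT (fun t => (X t ^+ 2)%:E) /\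
        ((\int[P]_t ((norm_ipl parent n t - X t) ^+ 2)%:E)%E @[n --> \oo]
           --> 0%E),
        (* non-degenerate *)
        ~ (exists c : R, {ae P, forall t, X t = c}) &
        (* fixed point characterisation, with X^(1) the corresponding
           limit for theta = 1 (random recursive tree) *)
        forall (d1 : measure_display) (T1 : measurableType d1)
               (P1 : probability T1 R) (parent1 : nat -> T1 -> nat)
               (X1 : T1 -> R),
          hoppe_process P1 1 parent1 -> measurable_fun setT X1 ->
          {ae P1, forall t, norm_ipl parent1 n t @[n --> \oo] --> X1 t} ->
          [/\ fpe_solution theta (law P1 X1) (law P X),
              (forall mu : probability R R,
                 (\int[mu]_x (`|x|%R)%:E < +oo)%E ->
                 fpe_solution_some theta (law P1 X1) mu ->
                 forall A : set R, measurable A -> mu A = law P X A) &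
              (theta != 1 ->
               forall mu : probability R R,
                 fpe_solution_some theta (law P1 X1) mu ->
                 forall A : set R, measurable A -> mu A = law P X A)]].
Proof.
have hP' := hoppe_process_clip htheta hP.
have rP t : recursive (clip parent ^~ t) by exact: recursive_clip.
pose X := ipl_limit (R := R) (clip parent).
have mX : measurable_fun setT X := measurable_ipl_limit htheta hP' rP.
have cX := ipl_limit_cvg_ae htheta hP' rP.
exists X; split => //.
- exact/(clip_limit htheta hP).
- split; first exact: (summable_ipl_limit2 htheta hP' rP mX cX).
  have := expect_ipl_error2_cvg0 htheta hP' rP mX cX.
  (* Clipping changes the path lengths on a null set only, so the L2 errors coincide. *)
  rewrite (_ : (fun n => \int[P]_t _)%E =
    fun n => (\int[P]_t ((norm_ipl parent n t - X t) ^+ 2)%:E)%E)//.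
  apply/funext => n; apply: ae_eq_integral => //.
  + apply/measurable_EFinP/measurable_funX/measurable_funB => //.
    exact: measurable_norm_ipl_any hP' n.
  + apply/measurable_EFinP/measurable_funX/measurable_funB => //.
    exact: measurable_norm_ipl_any hP n.
  + by apply: filterS (norm_ipl_clip_ae htheta hP) => t -> _.
- exact: (ipl_limit_nondegenerate htheta hP' rP mX cX).
move=> d1 T1 P1 parent1 X1 hP1 mX1 cX1.
have hP1' := hoppe_process_clip ltr01 hP1.
have rP1 t : recursive (clip parent1 ^~ t) by exact: recursive_clip.
have cX1' := (clip_limit ltr01 hP1 X1).1 cX1.
split=> [|mu _|_ mu].
- exact: (ipl_limit_fpe_solution htheta hP' rP hP1' rP1 mX mX1 cX cX1').
- exact: (ipl_limit_fpe_unique htheta hP' rP hP1' rP1 mX mX1 cX cX1').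
- exact: (ipl_limit_fpe_unique htheta hP' rP hP1' rP1 mX mX1 cX cX1').
Qed.
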